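(* Let $k$ be a quasi-noetherian commutative ring, $\mathbf{M}\in\mathbf{Pro}(k)$, $G\in\mathbf{Mod}(k)$, and let $$0\longleftarrow\mathbf{M}\longleftarrow\mathbf{P}_0\longleftarrow\mathbf{P}_1\longleftarrow\mathbf{P}_2\longleftarrow\cdots$$ be an exact sequence of pro-modules where all $\mathbf{P}_i$ are quasi-projective. Then the homology groups of the complex $\mathbf{P}_*\otimes_kG$ are naturally isomorphic to the torsion pro-modules: $$\mathbf{H}_n(\mathbf{P}_*\otimes_kG)\simeq\mathbf{Tor}_n^k(\mathbf{M},G),\qquad n\ge0.$$
   Context: $\mathbf{Mod}(k)$ is the category of $k$-modules. $\mathbf{Pro}(k)$ is the category of pro-objects in $\mathbf{Mod}(k)$: objects (pro-modules) are functors $\mathbf X=(X_i)_{i\in\mathbf I}:\mathbf I\to\mathbf{Mod}(k)$ with $\mathbf I$ a small cofiltrant category, and $Hom_{\mathbf{Pro}(k)}(\mathbf X,\mathbf Y)=\varprojlim_j\varinjlim_iHom_k(X_i,Y_j)$; it is an abelian category, and $\mathbf H_n$ of a complex of pro-modules is its homology in $\mathbf{Pro}(k)$. A pro-module $\mathbf P$ is quasi-projective if $Hom_{\mathbf{Pro}(k)}(\mathbf P,?):\mathbf{Mod}(k)\to\mathbf{Mod}(k)$ is exact. A commutative ring $k$ is quasi-noetherian if for every quasi-projective $\mathbf P\in\mathbf{Pro}(k)$ and every injective $J\in\mathbf{Mod}(k)$ the $k$-module $Hom_{\mathbf{Pro}(k)}(\mathbf P,J)$ is injective. For $\mathbf P\in\mathbf{Pro}(k)$,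 $M\in\mathbf{Mod}(k)$, $\mathbf P\otimes_kM\in\mathbf{Pro}(k)$ is the pro-module with $Hom_{\mathbf{Pro}(k)}(\mathbf P\otimes_kM,\mathbf N)\simeq Hom_k(M,Hom_{\mathbf{Pro}(k)}(\mathbf P,\mathbf N))$ naturally in $\mathbf N\in\mathbf{Pro}(k)$; this is a functor $\mathbf{Pro}(k)\times\mathbf{Mod}(k)\to\mathbf{Pro}(k)$. $\mathbf{Tor}_n^k(\mathbf M,G):=\mathbf H_n(\mathbf M\otimes_kQ_* )$, where $Q_*\to G$ is a projective resolution of $G$ in $\mathbf{Mod}(k)$. *)

(* Defs.v *)
From HB Require Import structures.
From mathcomp Require Import all_boot all_algebra boolp.

Set Implicit Arguments.
Unset Strict Implicit.
Unset Printing Implicit Defensive.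

Import GRing.Theory.
Local Open Scope ring_scope.
Local Open Scope quotient_scope.

Lemma linear_ext (k : pzRingType) (U V : lmodType k) (f g : {linear U -> V}) :
  f =1 g -> f = g.
Proof.
case: f => f [[a1] [b1] ]; case: g => g [[a2] [b2] ] /= /funext fg.
move: a1 b1 a2 b2; rewrite fg => a1 b1 a2 b2.
by congr GRing.Linear.Pack; congr GRing.Linear.Class; congr (_ _); exact: Prop_irrelevance.
Qed.

Definition mklin (k : pzRingType) (U V : lmodType k) (f : U -> V)
  (Hf : linear f) : {linear U -> V} :=
  HB.pack f (GRing.isLinear.Build k U V *:%R f Hf).

(* Objects and arrows end up in the universe of the carriers of modules: this is
   forced by kernel_of (one way) and by the modules prohom X Y (the other way). *)
Record smallCat := SmallCat {
  ob :> Type;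
  arr : ob -> ob -> Type;
  idm : forall i, arr i i;
  cmp : forall i j l, arr j l -> arr i j -> arr i l;
  cmp1m : forall i j (u : arr i j), cmp (idm j) u = u;
  cmpm1 : forall i j (u : arr i j), cmp u (idm i) = u;
  cmpA : forall i j l m (w : arr l m) (v : arr j l) (u : arr i j),
    cmp w (cmp v u) = cmp (cmp w v) u }.

Record cofiltrant (I : smallCat) : Prop := Cofiltrant {
  cof_inh : inhabited I;
  cof_cone : forall i j : I, exists l (u : arr l i) (v : arr l j), True;
  cof_eq : forall (i j : I) (u v : arr i j),
    exists l (w : arr l i), cmp u w = cmp v w }.

Section Pro.
Variable k : comPzRingType.

Record pro := Pro {
  idx : smallCat;
  idx_cof : cofiltrant idx;
  pob :> idx -> lmodType k;
  pmap : forall i j : idx, arr i j -> {linear pob i -> pob j};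
  pmap1 : forall i x, pmap (idm i) x = x;
  pmapM : forall (i j l : idx) (v : arr j l) (u : arr i j) x,
    pmap (cmp v u) x = pmap v (pmap u x) }.
Arguments pmap X [i j] u : rename.

Section Colim.
Variables (X : pro) (N : lmodType k).

Record germ := Germ { gidx : idx X; gfun : {linear X gidx -> N} }.
HB.instance Definition _ := gen_eqMixin germ.
HB.instance Definition _ := gen_choiceMixin germ.

Definition germ_eq (a b : germ) : Prop :=
  exists l (u : arr l (gidx a)) (v : arr l (gidx b)),
    forall x, gfun a (pmap X u x) = gfun b (pmap X v x).

Definition germ_rel (a b : germ) : bool := `[< germ_eq a b >].

Lemma idx_cone2 (i j : idx X) :
  exists l (u : arr l i) (v : arr l j), True.
Proof. exact: (cof_cone (idx_cof X)). Qed.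

Lemma idx_sq (i j l : idx X) (u : arr i l) (v : arr j l) :
  exists m (u' : arr m i) (v' : arr m j), cmp u u' = cmp v v'.
Proof.
have [m [u' [v' _]]] := idx_cone2 i j.
have [n [w e]] := cof_eq (idx_cof X) (cmp u u') (cmp v v').
by exists n, (cmp u' w), (cmp v' w); rewrite !cmpA.
Qed.

Lemma germ_equiv : equiv_class_of germ_rel.
Proof.
split=> [a|a b|b a c].
- by apply/asboolP; exists (gidx a), (idm _), (idm _).
- by apply/asboolP/asboolP => -[l [u [v e]]]; exists l, v, u => x; rewrite e.
- move=> /asboolP[l [u [v e]]] /asboolP[l' [u' [v' e']]]; apply/asboolP.
  have [m [w [w' ww]]] := idx_sq v u'.
  exists m, (cmp u w), (cmp v' w') => x.
  by rewrite !pmapM e -e' -!pmapM ww.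
Qed.

Canonical germ_equiv_rel := EquivRelPack germ_equiv.

(* The filtered colimit of Hom_k(X_i, N) over the opposite of the index
   category. *)
Definition colim := {eq_quot germ_equiv_rel}.
HB.instance Definition _ : EqQuotient _ germ_equiv_rel colim := EqQuotient.on colim.
HB.instance Definition _ := Choice.on colim.

Definition cls (i : idx X) (f : {linear X i -> N}) : colim := \pi_colim (Germ f).

Lemma clsP i (f : {linear X i -> N}) j (g : {linear X j -> N}) :
  cls f = cls g <-> exists l (u : arr l i) (v : arr l j),
    forall x, f (pmap X u x) = g (pmap X v x).
Proof. by split=> [/eqquotP/asboolP//|H]; apply/eqquotP/asboolP. Qed.

Lemma clsW (c : colim) : exists i (f : {linear X i -> N}), c = cls f.
Proof.
by exists (gidx (repr c)), (gfun (repr c)); rewrite /cls; case: (repr c) (reprK c).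
Qed.

Lemma cls_pull i j (u : arr j i) (f : {linear X i -> N}) :
  cls f = cls (f \o pmap X u).
Proof. by apply/clsP; exists j, u, (idm j) => x /=; rewrite pmap1. Qed.

Lemma clsW2 (c d : colim) :
  exists i (f g : {linear X i -> N}), c = cls f /\ d = cls g.
Proof.
have [i [f ->]] := clsW c; have [j [g ->]] := clsW d.
have [l [u [v _]]] := idx_cone2 i j.
by exists l, (f \o pmap X u), (g \o pmap X v); split; exact: cls_pull.
Qed.

Lemma clsW3 (c d e : colim) :
  exists i (f g h : {linear X i -> N}), [/\ c = cls f, d = cls g & e = cls h].
Proof.
have [i [f [g [-> ->]]]] := clsW2 c d; have [j [h ->]] := clsW e.
have [l [u [v _]]] := idx_cone2 i j.
by exists l, (f \o pmap X u), (g \o pmap X u), (h \o pmap X v); split; exact: cls_pull.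
Qed.

Definition colim_add (c d : colim) : colim :=
  let: a := repr c in let: b := repr d in
  let: exist l H := cid (idx_cone2 (gidx a) (gidx b)) in
  let: exist u H := cid H in let: exist v _ := cid H in
  cls ((gfun a \o pmap X u) \+ (gfun b \o pmap X v)).

Definition colim_opp (c : colim) : colim := cls (\- gfun (repr c)).

Definition colim_scale (a : k) (c : colim) : colim := cls (a \*: gfun (repr c)).

Definition colim_zero : colim :=
  cls (\0 : {linear X (sval (cid (let: inhabits i := cof_inh (idx_cof X) in
    ex_intro (fun=> True) i I))) -> N}).

Lemma cls_repr i (f : {linear X i -> N}) : exists l u (v : arr l i),
  forall x, gfun (repr (cls f)) (pmap X u x) = f (pmap X v x).
Proof.
apply/(clsP (gfun (repr (cls f))) f).
by rewrite -[RHS]reprK /cls; case: (repr (\pi _)).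
Qed.

Lemma colim_addE i (f g : {linear X i -> N}) :
  colim_add (cls f) (cls g) = cls (f \+ g).
Proof.
rewrite /colim_add; case: cid => l H; case: cid => u {}H; case: cid => v _.
apply/clsP.
have [l1 [u1 [v1 e1]]] := cls_repr f; have [l2 [u2 [v2 e2]]] := cls_repr g.
have [m1 [a1 [b1 E1]]] := idx_sq u u1; have [m2 [a2 [b2 E2]]] := idx_sq v u2.
have [m [c1 [c2 E]]] := idx_sq a1 a2.
have [n [w W]] := cof_eq (idx_cof X) (cmp v1 (cmp b1 c1)) (cmp v2 (cmp b2 c2)).
exists n, (cmp (cmp a1 c1) w), (cmp (cmp v1 (cmp b1 c1)) w) => x /=.
congr (_ + _).
- by rewrite -pmapM !cmpA E1 -!cmpA pmapM e1 -pmapM.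
- by rewrite -pmapM E W !cmpA E2 -!cmpA pmapM e2 -pmapM.
Qed.

Lemma colim_oppE i (f : {linear X i -> N}) : colim_opp (cls f) = cls (\- f).
Proof.
have [l [u [v e]]] := cls_repr f.
by apply/clsP; exists l, u, v => x /=; rewrite e.
Qed.

Lemma colim_scaleE a i (f : {linear X i -> N}) :
  colim_scale a (cls f) = cls (a \*: f).
Proof.
have [l [u [v e]]] := cls_repr f.
by apply/clsP; exists l, u, v => x /=; rewrite e.
Qed.

Lemma cls_ext i (f g : {linear X i -> N}) : f =1 g -> cls f = cls g.
Proof. by move=> /linear_ext ->. Qed.

Lemma colim_zeroE i : colim_zero = cls (\0 : {linear X i -> N}).
Proof.
rewrite /colim_zero; set i0 := sval _.
have [l [u [v _]]] := idx_cone2 i0 i.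
by apply/clsP; exists l, u, v.
Qed.

Let addA : associative colim_add.
Proof.
move=> c d e; have [i [f [g [h [-> -> ->]]]]] := clsW3 c d e.
by rewrite !colim_addE; apply: cls_ext => x /=; rewrite addrA.
Qed.
Let addC : commutative colim_add.
Proof.
move=> c d; have [i [f [g [-> ->]]]] := clsW2 c d.
by rewrite !colim_addE; apply: cls_ext => x /=; rewrite addrC.
Qed.
Let add0 : left_id colim_zero colim_add.
Proof.
move=> c; have [i [f ->]] := clsW c.
by rewrite (colim_zeroE i) !colim_addE; apply: cls_ext => x /=; rewrite add0r.
Qed.
Let addN : left_inverse colim_zero colim_opp colim_add.
Proof.
move=> c; have [i [f ->]] := clsW c.
rewrite (colim_zeroE i) colim_oppE !colim_addE; apply: cls_ext => x /=.
by rewrite addNr.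
Qed.
HB.instance Definition _ := GRing.isZmodule.Build colim addA addC add0 addN.

Lemma clsD i (f g : {linear X i -> N}) : cls f + cls g = cls (f \+ g).
Proof. exact: colim_addE. Qed.
Lemma clsN i (f : {linear X i -> N}) : - cls f = cls (\- f).
Proof. exact: colim_oppE. Qed.
Lemma cls0 i : 0 = cls (\0 : {linear X i -> N}).
Proof. exact: colim_zeroE. Qed.

Let scaleA a b c : colim_scale a (colim_scale b c) = colim_scale (a * b) c.
Proof.
have [i [f ->]] := clsW c.
by rewrite !colim_scaleE; apply: cls_ext => x /=; rewrite scalerA.
Qed.
Let scale1 : left_id 1 colim_scale.
Proof.
move=> c; have [i [f ->]] := clsW c.
by rewrite !colim_scaleE; apply: cls_ext => x /=; rewrite scale1r.
Qed.
Let scaleDr : right_distributive colim_scale +%R.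
Proof.
move=> a c d; have [i [f [g [-> ->]]]] := clsW2 c d.
by rewrite clsD !colim_scaleE clsD; apply: cls_ext => x /=; rewrite scalerDr.
Qed.
Let scaleDl c : {morph colim_scale^~ c : a b / a + b}.
Proof.
move=> a b; have [i [f ->]] := clsW c.
by rewrite !colim_scaleE clsD; apply: cls_ext => x /=; rewrite scalerDl.
Qed.
HB.instance Definition _ :=
  GRing.Zmodule_isLmodule.Build k colim scaleA scale1 scaleDr scaleDl.

Lemma clsZ a i (f : {linear X i -> N}) : a *: cls f = cls (a \*: f).
Proof. exact: colim_scaleE. Qed.

Lemma cls_eq0 i (f : {linear X i -> N}) :
  cls f = 0 <-> exists l (u : arr l i), forall x, f (pmap X u x) = 0.
Proof.
rewrite (cls0 i) clsP; split=> [[l [u [v e]]]|[l [u e]]].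
  by exists l, u => x; rewrite e.
by exists l, u, u => x; rewrite e.
Qed.

End Colim.

Section Push.
Variables (X : pro) (N N' : lmodType k) (h : {linear N -> N'}).

Definition push (c : colim X N) : colim X N' := cls (h \o gfun (repr c)).

Lemma pushE i (f : {linear X i -> N}) : push (cls f) = cls (h \o f).
Proof.
have [l [u [v e]]] := cls_repr f.
by apply/clsP; exists l, u, v => x /=; rewrite e.
Qed.

Lemma push_linear : linear push.
Proof.
move=> a c d; have [i [f [g [-> ->]]]] := clsW2 c d.
rewrite clsZ clsD !pushE clsZ clsD; apply: cls_ext => x /=.
by rewrite linearP.
Qed.
HB.instance Definition _ :=
  GRing.isLinear.Build k (colim X N) (colim X N') *:%R push push_linear.
End Push.

Section PushComp.
Variable X : pro.

Lemma push_comp (N N' N'' : lmodType k) (g : {linear N' -> N''})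
  (h : {linear N -> N'}) (c : colim X N) : push g (push h c) = push (g \o h) c.
Proof. by have [i [f ->]] := clsW c; rewrite !pushE; exact: cls_ext. Qed.

Lemma push_id (N : lmodType k) (h : {linear N -> N}) (c : colim X N) :
  h =1 id -> push h c = c.
Proof.
move=> hid; have [i [f ->]] := clsW c; rewrite !pushE; apply: cls_ext => x /=.
by rewrite hid.
Qed.

Lemma push_inj (N N' : lmodType k) (h : {linear N -> N'}) :
  injective h -> injective (push h : colim X N -> _).
Proof.
move=> hinj c d; have [i [f [g [-> ->]]]] := clsW2 c d.
rewrite !pushE => /clsP[l [u [v e]]]; apply/clsP; exists l, u, v => x.
exact/hinj/e.
Qed.

Lemma eq_push (N N' : lmodType k) (h h' : {linear N -> N'}) (c : colim X N) :
  h =1 h' -> push h c = push h' c.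
Proof. by move=> /linear_ext ->. Qed.
End PushComp.

Section ProHom.
Variables X Y : pro.

(* An element of lim_j colim_i Hom_k(X_i, Y_j). *)
Record prohom := ProHom {
  pcomp :> forall j : idx Y, colim X (Y j);
  pcompat : forall (j j' : idx Y) (v : arr j j'),
    push (pmap Y v) (pcomp j) = pcomp j' }.
HB.instance Definition _ := gen_eqMixin prohom.
HB.instance Definition _ := gen_choiceMixin prohom.

Lemma prohom_ext (f g : prohom) : (forall j, f j = g j) -> f = g.
Proof.
case: f g => f cf [g cg] /= fg; have {fg} fg : f = g by exact: functional_extensionality_dep.
by move: cf cg; rewrite fg => cf cg; congr ProHom; exact: Prop_irrelevance.
Qed.

Definition prohom_add (f g : prohom) : prohom.
Proof.
exists (fun j => f j + g j) => j j' v.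
by rewrite linearD /= !pcompat.
Defined.
Definition prohom_opp (f : prohom) : prohom.
Proof.
exists (fun j => - f j) => j j' v.
by rewrite linearN /= !pcompat.
Defined.
Definition prohom_zero : prohom.
Proof. by exists (fun j => 0) => j j' v; rewrite linear0. Defined.
Definition prohom_scale (a : k) (f : prohom) : prohom.
Proof.
exists (fun j => a *: f j) => j j' v.
by rewrite linearZ_LR /= !pcompat.
Defined.

Let addA : associative prohom_add.
Proof. by move=> f g h; apply: prohom_ext => j /=; rewrite addrA. Qed.
Let addC : commutative prohom_add.
Proof. by move=> f g; apply: prohom_ext => j /=; rewrite addrC. Qed.
Let add0 : left_id prohom_zero prohom_add.
Proof. by move=> f; apply: prohom_ext => j /=; rewrite add0r. Qed.
Let addN : left_inverse prohom_zero prohom_opp prohom_add.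
Proof. by move=> f; apply: prohom_ext => j /=; rewrite addNr. Qed.
HB.instance Definition _ := GRing.isZmodule.Build prohom addA addC add0 addN.

Let scaleA a b c : prohom_scale a (prohom_scale b c) = prohom_scale (a * b) c.
Proof. by apply: prohom_ext => j /=; rewrite scalerA. Qed.
Let scale1 : left_id 1 prohom_scale.
Proof. by move=> f; apply: prohom_ext => j /=; rewrite scale1r. Qed.
Let scaleDr : right_distributive prohom_scale +%R.
Proof. by move=> a f g; apply: prohom_ext => j /=; rewrite scalerDr. Qed.
Let scaleDl c : {morph prohom_scale^~ c : a b / a + b}.
Proof. by move=> a b; apply: prohom_ext => j /=; rewrite scalerDl. Qed.
HB.instance Definition _ :=
  GRing.Zmodule_isLmodule.Build k prohom scaleA scale1 scaleDr scaleDl.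
End ProHom.

Section Pull.
Variables (X Y : pro) (f : prohom X Y) (N : lmodType k).

(* Precomposition with f, from colim_j Hom_k(Y_j, N) to colim_i Hom_k(X_i, N). *)
Definition pull (c : colim Y N) : colim X N :=
  push (gfun (repr c)) (f (gidx (repr c))).

Lemma pullE j (h : {linear Y j -> N}) : pull (cls h) = push h (f j).
Proof.
rewrite /pull; have [l [u [v e]]] := cls_repr h.
by rewrite -(pcompat f u) -(pcompat f v) !push_comp; exact: eq_push.
Qed.

Lemma pull_linear : linear pull.
Proof.
move=> a c d; have [j [g [h [-> ->]]]] := clsW2 c d.
rewrite clsZ clsD !pullE; have [i [p ->]] := clsW (f j).
by rewrite !pushE clsZ clsD; apply: cls_ext.
Qed.
HB.instance Definition _ :=
  GRing.isLinear.Build k (colim Y N) (colim X N) *:%R pull pull_linear.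
End Pull.

Lemma pull_push (X Y : pro) (f : prohom X Y) (N N' : lmodType k)
  (h : {linear N -> N'}) (c : colim Y N) :
  push h (pull f c) = pull f (push h c).
Proof. by have [j [g ->]] := clsW c; rewrite pushE !pullE push_comp. Qed.

Definition pid (X : pro) : prohom X X.
Proof.
exists (fun i => cls (idfun : {linear X i -> X i})) => j j' v; rewrite pushE.
by rewrite [RHS](cls_pull v); exact: cls_ext.
Defined.

Definition pcompose (X Y Z : pro) (g : prohom Y Z) (f : prohom X Y) : prohom X Z.
Proof.
by exists (fun l => pull f (g l)) => l l' w; rewrite pull_push pcompat.
Defined.

End Pro.

Arguments pmap {k} X [i j] u : rename.
Notation "g \po f" := (pcompose g f) (at level 40, left associativity).

Section ProTheory.
Variable k : comPzRingType.
Implicit Types X Y Z W : pro k.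

Lemma pcompo1 X Y (f : prohom X Y) : f \po pid X = f.
Proof.
apply: prohom_ext => j /=; have [i [g ->]] := clsW (f j).
by rewrite pullE /= pushE; exact: cls_ext.
Qed.

Lemma pcomp1o X Y (f : prohom X Y) : pid Y \po f = f.
Proof. by apply: prohom_ext => j /=; rewrite pullE push_id. Qed.

Lemma pull_comp X Y Z (g : prohom Y Z) (f : prohom X Y) (N : lmodType k)
  (c : colim Z N) : pull f (pull g c) = pull (g \po f) c.
Proof. by have [l [h ->]] := clsW c; rewrite (pullE g) (pullE (_ \po _)) pull_push. Qed.

Lemma pcompoA X Y Z W (h : prohom Z W) (g : prohom Y Z) (f : prohom X Y) :
  h \po (g \po f) = (h \po g) \po f.
Proof. by apply: prohom_ext => m /=; rewrite pull_comp. Qed.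

Lemma pcompoPl X Y Z (g : prohom Y Z) (f f' : prohom X Y) a :
  g \po (a *: f + f') = a *: (g \po f) + g \po f'.
Proof.
apply: prohom_ext => l /=; have [j [h ->]] := clsW (g l).
by rewrite !pullE linearP.
Qed.

Lemma pcompoPr X Y Z (g g' : prohom Y Z) (f : prohom X Y) a :
  (a *: g + g') \po f = a *: (g \po f) + g' \po f.
Proof. by apply: prohom_ext => l /=; rewrite linearP. Qed.

Lemma pcompo0 X Y Z (g : prohom Y Z) : g \po (0 : prohom X Y) = 0.
Proof.
have := pcompoPl g (0 : prohom X Y) 0 1; rewrite scale1r addr0 scale1r.
by move/(congr1 (+%R (- (g \po 0)))); rewrite addNr addKr => <-.
Qed.

Lemma pcomp0o X Y Z (f : prohom X Y) : (0 : prohom Y Z) \po f = 0.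
Proof. by apply: prohom_ext => l /=; rewrite linear0. Qed.
End ProTheory.

(* Quotient of a term algebra T by the kernel of a class Ev of evaluations of T
   in modules; direct sums and cokernels of modules are obtained from it. *)
Record termAlg (k : comPzRingType) := TermAlg {
  term :> Type;
  t0 : term; tadd : term -> term -> term; topp : term -> term;
  tscale : k -> term -> term;
  evals : forall N : lmodType k, (term -> N) -> Prop;
  eval0 : forall (N : lmodType k) (e : term -> N), evals e -> e t0 = 0;
  evalD : forall (N : lmodType k) (e : term -> N), evals e -> forall x y, e (tadd x y) = e x + e y;
  evalN : forall (N : lmodType k) (e : term -> N), evals e -> forall x, e (topp x) = - e x;
  evalZ : forall (N : lmodType k) (e : term -> N), evals e ->
    forall a x, e (tscale a x) = a *: e x }.

Section TermQuot.
Variables (k : comPzRingType) (A : termAlg k).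
HB.instance Definition _ := gen_eqMixin (term A).
HB.instance Definition _ := gen_choiceMixin (term A).

Definition teq (x y : term A) : bool :=
  `[< forall (N : lmodType k) (e : A -> N), evals e -> e x = e y >].

Lemma teq_equiv : equiv_class_of teq.
Proof.
split=> [x|x y|y x z]; first by apply/asboolP.
- by apply/asboolP/asboolP => H N e He; rewrite H.
- by move=> /asboolP H1 /asboolP H2; apply/asboolP => N e He; rewrite H1 ?H2.
Qed.
Canonical teq_equiv_rel := EquivRelPack teq_equiv.

Definition tquot := {eq_quot teq_equiv_rel}.
HB.instance Definition _ : EqQuotient _ teq_equiv_rel tquot := EqQuotient.on tquot.
HB.instance Definition _ := Choice.on tquot.

Definition tcl (x : term A) : tquot := \pi_tquot x.

Lemma tclP x y : tcl x = tcl y <->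
  forall (N : lmodType k) (e : A -> N), evals e -> e x = e y.
Proof. by split=> [/eqquotP/asboolP//|H]; apply/eqquotP/asboolP. Qed.

Lemma tclK (c : tquot) : tcl (repr c) = c.
Proof. exact: reprK. Qed.

Lemma tcl_repr x (N : lmodType k) (e : A -> N) : evals e -> e (repr (tcl x)) = e x.
Proof. by move=> He; apply: (tclP _ _).1 => //; exact: tclK. Qed.

Definition tq0 : tquot := tcl (t0 A).
Definition tqadd (c d : tquot) : tquot := tcl (tadd (repr c) (repr d)).
Definition tqopp (c : tquot) : tquot := tcl (topp (repr c)).
Definition tqscale a (c : tquot) : tquot := tcl (tscale a (repr c)).

Ltac tq := repeat (match goal with c : tquot |- _ =>
    rewrite -(tclK c); move: (repr c) => {}c end);
  apply/tclP => ? ? ?; match goal with He : evals _ |- _ =>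
    rewrite !(evalD He, evalN He, evalZ He, tcl_repr _ He, eval0 He) end.

Let addA : associative tqadd.
Proof. by move=> c d e; tq; rewrite addrA. Qed.
Let addC : commutative tqadd.
Proof. by move=> c d; tq; rewrite addrC. Qed.
Let add0 : left_id tq0 tqadd.
Proof. by move=> c; tq; rewrite add0r. Qed.
Let addN : left_inverse tq0 tqopp tqadd.
Proof. by move=> c; tq; rewrite addNr. Qed.
HB.instance Definition _ := GRing.isZmodule.Build tquot addA addC add0 addN.
Let scaleA a b c : tqscale a (tqscale b c) = tqscale (a * b) c.
Proof. by tq; rewrite scalerA. Qed.
Let scale1 : left_id 1 tqscale.
Proof. by move=> c; tq; rewrite scale1r. Qed.
Let scaleDr : right_distributive tqscale +%R.
Proof. by move=> a c d; rewrite /GRing.add /=; tq; rewrite scalerDr. Qed.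
Let scaleDl c : {morph tqscale^~ c : a b / a + b}.
Proof. by move=> a b; rewrite [in RHS]/GRing.add /=; tq; rewrite scalerDl. Qed.
HB.instance Definition _ :=
  GRing.Zmodule_isLmodule.Build k tquot scaleA scale1 scaleDr scaleDl.

Lemma tcl0 : tcl (t0 A) = 0. Proof. by []. Qed.
Lemma tclD x y : tcl (tadd x y) = tcl x + tcl y.
Proof. by rewrite /GRing.add /=; tq. Qed.
Lemma tclN x : tcl (topp x) = - tcl x.
Proof. by rewrite /GRing.opp /=; tq. Qed.
Lemma tclZ a x : tcl (tscale a x) = a *: tcl x.
Proof. by rewrite /GRing.scale /=; tq. Qed.

Lemma tquot_desc (N : lmodType k) (e : A -> N) (He : evals e) :
  exists l : {linear tquot -> N}, forall x, l (tcl x) = e x.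
Proof.
have le : linear (fun c : tquot => e (repr c)).
  move=> a c d; rewrite -(tclK c) -(tclK d) -tclZ -tclD !tcl_repr //.
  by rewrite (evalD He) (evalZ He).
by exists (mklin le) => x; exact: tcl_repr.
Qed.

Lemma tquot_ext (N : lmodType k) (f g : {linear tquot -> N}) :
  (forall x, f (tcl x) = g (tcl x)) -> f = g.
Proof. by move=> fg; apply: linear_ext => c; rewrite -(tclK c). Qed.
End TermQuot.

Section ModCoker.
Variables (k : comPzRingType) (U V : lmodType k) (f : {linear U -> V}).

Definition coker_alg : termAlg k.
Proof.
exists V 0 +%R (@GRing.opp V) *:%R
  (fun N e => linear e /\ forall x, e (f x) = 0) => N e [le _].
- exact: (linear0 (mklin le)).
- exact: (linearD (mklin le)).
- exact: (linearN (mklin le)).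
- exact: (linearZ_LR (mklin le)).
Defined.

Definition mcoker : lmodType k := tquot coker_alg.

Lemma mcoker_proj_linear : linear (@tcl k coker_alg : V -> mcoker).
Proof. by move=> a x y; rewrite -tclZ -tclD. Qed.
Definition mproj : {linear V -> mcoker} := mklin mcoker_proj_linear.

Lemma mproj0 x : mproj (f x) = 0.
Proof. by rewrite -[RHS]tcl0; apply/tclP => N e [le e0]; rewrite e0 -(linear0 (mklin le)). Qed.

Lemma mcoker_desc (N : lmodType k) (h : {linear V -> N}) :
  (forall x, h (f x) = 0) -> exists l : {linear mcoker -> N}, forall x, l (mproj x) = h x.
Proof.
move=> h0; apply: (@tquot_desc k coker_alg N h); split=> // a x y.
exact: linearP.
Qed.

Lemma mcoker_ext (N : lmodType k) (h h' : {linear mcoker -> N}) :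
  (forall x, h (mproj x) = h' (mproj x)) -> h = h'.
Proof. by move=> hh'; apply: tquot_ext => x; exact: hh'. Qed.
End ModCoker.
Opaque mproj.

Section ModSum.
Variables (k : comPzRingType) (S : Type) (A : S -> lmodType k).

Inductive sterm := SInj s of A s | SZero | SAdd of sterm & sterm
  | SOpp of sterm | SScale of k & sterm.

Fixpoint seval (N : lmodType k) (h : forall s, {linear A s -> N}) (t : sterm) : N :=
  match t with
  | SInj s x => h s x | SZero => 0 | SAdd t u => seval h t + seval h u
  | SOpp t => - seval h t | SScale a t => a *: seval h t
  end.

Definition sum_alg : termAlg k.
Proof.
by exists sterm SZero SAdd SOpp SScale
  (fun (N : lmodType k) e => exists h : forall s, {linear A s -> N}, e = seval h) => N _ [h ->].
Defined.

Definition msum : lmodType k := tquot sum_alg.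

Lemma msum_in_linear s : linear ((fun x => tcl (SInj x : sum_alg)) : A s -> msum).
Proof.
move=> a x y; rewrite -tclZ -tclD; apply/tclP => N _ [h ->] /=.
exact: linearP.
Qed.
Definition msum_in s : {linear A s -> msum} := mklin (@msum_in_linear s).

Lemma msum_desc (N : lmodType k) (h : forall s, {linear A s -> N}) :
  exists l : {linear msum -> N}, forall s x, l (msum_in s x) = h s x.
Proof.
have [|l hl] := @tquot_desc k sum_alg N (seval h); first by exists h.
by exists l => s x; rewrite [LHS]hl.
Qed.

Lemma msum_ext (N : lmodType k) (f g : {linear msum -> N}) :
  (forall s x, f (msum_in s x) = g (msum_in s x)) -> f = g.
Proof.
move=> fg; apply: tquot_ext; elim=> [s x||t et u eu|t et|a t et].
- exact: fg.
- by rewrite !linear0.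
- by rewrite tclD !linearD et eu.
- by rewrite tclN !linearN et.
- by rewrite tclZ !linearZ_LR et.
Qed.
End ModSum.
Opaque msum_in.

Section ModKer.
Variables (k : comPzRingType) (U V : lmodType k) (f : {linear U -> V}).

Definition in_ker : pred U := fun x => f x == 0.
Lemma in_ker_submod : submod_closed in_ker.
Proof.
split=> [|a x y]; rewrite /in_ker !unfold_in ?linear0 // => /eqP fx /eqP fy.
by rewrite linearP fx fy scaler0 addr0.
Qed.
HB.instance Definition _ := GRing.isSubmodClosed.Build k U in_ker in_ker_submod.

Record mker_sub := MKer { mker_val : U; _ : mker_val \in in_ker }.
HB.instance Definition _ := [isSub for mker_val].
HB.instance Definition _ := [Choice of mker_sub by <:].
HB.instance Definition _ := [SubChoice_isSubLmodule of mker_sub by <:].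
Definition mker : lmodType k := mker_sub.

Lemma mker_incl_linear : linear (mker_val : mker -> U).
Proof. by move=> a x y; rewrite -[mker_val _]/(val _) linearP. Qed.
Definition mincl : {linear mker -> U} := mklin mker_incl_linear.

Lemma mincl_inj : injective mincl.
Proof. exact: val_inj. Qed.

Lemma mincl0 x : f (mincl x) = 0.
Proof. by case: x => x /= /eqP. Qed.

Lemma mker_lift (W : lmodType k) (h : {linear W -> U}) :
  (forall x, f (h x) = 0) -> exists l : {linear W -> mker}, forall x, mincl (l x) = h x.
Proof.
move=> h0; have hP x : h x \in in_ker by apply/eqP.
have ll : linear (fun x => MKer (hP x)).
  by move=> a x y; apply: mincl_inj; rewrite [RHS]linearP; exact: linearP.
by exists (mklin ll).
Qed.
End ModKer.
Opaque mincl.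

Lemma dchoice (S : Type) (T : S -> Type) (R : forall s, T s -> Prop) :
  (forall s, exists x, R s x) -> exists g : forall s, T s, forall s, R s (g s).
Proof. by move=> H; exists (fun s => sval (cid (H s))) => s; case: cid. Qed.

(* Pro(k) has kernels, cokernels and coproducts: only their universal
   properties are used outside kernel_of, cokernel_of and coproduct_of. *)
Section Universal.
Variable k : comPzRingType.

Record kernel (X Y : pro k) (f : prohom X Y) := Kernel {
  ker_obj : pro k;
  ker_in : prohom ker_obj X;
  ker_in0 : f \po ker_in = 0;
  ker_univ : forall (W : pro k) (h : prohom W X), f \po h = 0 ->
    exists! l : prohom W ker_obj, ker_in \po l = h }.

Record cokernel (X Y : pro k) (f : prohom X Y) := Cokernel {
  cok_obj : pro k;
  cok_out : prohom Y cok_obj;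
  cok_out0 : cok_out \po f = 0;
  cok_univ : forall (W : pro k) (h : prohom Y W), h \po f = 0 ->
    exists! l : prohom cok_obj W, l \po cok_out = h }.

Record coproduct (S : Type) (P : S -> pro k) := Coproduct {
  cop_obj : pro k;
  cop_in : forall s, prohom (P s) cop_obj;
  cop_univ : forall (W : pro k) (h : forall s, prohom (P s) W),
    exists! l : prohom cop_obj W, forall s, l \po cop_in s = h s }.

End Universal.

Section Level.
Variables (k : comPzRingType) (X Y : pro k) (f : prohom X Y).

(* The category of linear maps X_i -> Y_j representing f, over which f becomes
   a morphism of diagrams. *)
Record lvl := Lvl {
  lsrc : idx X; ltgt : idx Y; lmap : {linear X lsrc -> Y ltgt};
  lvlP : cls lmap = f ltgt }.

Record larr (t t' : lvl) := LArr {
  asrc : arr (lsrc t) (lsrc t'); atgt : arr (ltgt t) (ltgt t');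
  larrP : forall x, lmap t' (pmap X asrc x) = pmap Y atgt (lmap t x) }.

Lemma larr_ext t t' (a b : larr t t') : asrc a = asrc b -> atgt a = atgt b -> a = b.
Proof.
case: a b => a1 a2 aP [b1 b2 bP] /= e1 e2; subst.
by congr LArr; exact: Prop_irrelevance.
Qed.

Definition lid t : larr t t.
Proof. by exists (idm _) (idm _) => x; rewrite !pmap1. Defined.
Definition lcmp t1 t2 t3 (b : larr t2 t3) (a : larr t1 t2) : larr t1 t3.
Proof.
by exists (cmp (asrc b) (asrc a)) (cmp (atgt b) (atgt a)) => x; rewrite !pmapM -!larrP.
Defined.

Definition lvlCat : smallCat.
Proof.
exists lvl larr lid lcmp => *; apply: larr_ext; rewrite /= ?(cmp1m, cmpm1) //; exact: cmpA.
Defined.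

Lemma lvl_rep j : exists i (p : {linear X i -> Y j}), cls p = f j.
Proof. by have [i [p e]] := clsW (f j); exists i, p. Qed.

Lemma cls_pmap i i' (u : arr i' i) j (p : {linear X i -> Y j}) :
  cls p = f j -> cls (p \o pmap X u) = f j.
Proof. by move<-; rewrite -cls_pull. Qed.

Lemma lvl_refine (t : lvl) i1 j1 (p : {linear X i1 -> Y j1}) (v : arr j1 (ltgt t)) :
  cls p = f j1 -> exists l (a : arr l i1) (b : arr l (lsrc t)),
    forall x, lmap t (pmap X b x) = pmap Y v (p (pmap X a x)).
Proof.
move=> e; have /clsP[l [a [b E]]] : cls (pmap Y v \o p) = cls (lmap t).
  by rewrite -pushE e pcompat lvlP.
by exists l, a, b => x; rewrite -E.
Qed.

Lemma lvl_dom (t : lvl) i (w : arr i (lsrc t)) : exists t' (a : larr t' t) (e : lsrc t' = i),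
  asrc a = ecast i (arr i _) (esym e) w.
Proof.
have H x : lmap t (pmap X w x) = pmap Y (idm _) ((lmap t \o pmap X w) x).
  by rewrite pmap1.
by exists (Lvl (cls_pmap w (lvlP t))), (@LArr (Lvl (cls_pmap w (lvlP t))) t w _ H), erefl.
Qed.

Lemma lvl_cod (t : lvl) j (w : arr j (ltgt t)) : exists t' (a : larr t' t) (e : ltgt t' = j),
  atgt a = ecast i (arr i _) (esym e) w.
Proof.
have [i [p e]] := lvl_rep j; have [l [a [b E]]] := lvl_refine w e.
by exists (Lvl (cls_pmap a e)), (@LArr (Lvl (cls_pmap a e)) t b w E), erefl.
Qed.

Lemma lvl_cof : cofiltrant lvlCat.
Proof.
split.
- have [j] := cof_inh (idx_cof Y); have [i [p e]] := lvl_rep j.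
  by split; exact: (Lvl e).
- move=> t t'; have [j1 [v [v' _]]] := cof_cone (idx_cof Y) (ltgt t) (ltgt t').
  have [i1 [p e]] := lvl_rep j1.
  have [l [a [b E]]] := lvl_refine v e; have [l' [a' [b' E']]] := lvl_refine v' e.
  have [m [c [c' C]]] := idx_sq a a'.
  have H x : lmap t (pmap X (cmp b c) x) = pmap Y v ((p \o pmap X (cmp a c)) x).
    by rewrite /= !pmapM E.
  have H' x : lmap t' (pmap X (cmp b' c') x) = pmap Y v' ((p \o pmap X (cmp a c)) x).
    by rewrite /= C !pmapM E'.
  pose r := Lvl (cls_pmap (cmp a c) e).
  by exists r, (@LArr r t _ _ H), (@LArr r t' _ _ H').
- move=> t t' u v; have [i [w W]] := cof_eq (idx_cof X) (asrc u) (asrc v).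
  have [j [z Z]] := cof_eq (idx_cof Y) (atgt u) (atgt v).
  have [i1 [p e]] := lvl_rep j; have [l [a [b E]]] := lvl_refine z e.
  have [m [c [c' C]]] := idx_sq b w.
  have H x : lmap t (pmap X (cmp b c) x) = pmap Y z ((p \o pmap X (cmp a c)) x).
    by rewrite /= !pmapM E.
  pose r := Lvl (cls_pmap (cmp a c) e).
  exists r, (@LArr r t _ _ H); apply: larr_ext => //=.
  by rewrite C !cmpA W.
Qed.

Lemma kmap_ex t t' (a : larr t t') :
  exists l : {linear mker (lmap t) -> mker (lmap t')},
    forall x, mincl _ (l x) = pmap X (asrc a) (mincl _ x).
Proof.
apply: (mker_lift (h := pmap X (asrc a) \o mincl _)) => x /=.
by rewrite larrP [lmap t _]mincl0 linear0.
Qed.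
Definition kmap t t' (a : larr t t') : {linear mker (lmap t) -> mker (lmap t')} := sval (cid (kmap_ex a)).
Lemma kmapE t t' (a : larr t t') x : mincl _ (kmap a x) = pmap X (asrc a) (mincl _ x).
Proof. by rewrite /kmap; case: cid. Qed.

Lemma kmap1 t x : kmap (lid t) x = x.
Proof. by apply: mincl_inj; rewrite kmapE /= pmap1. Qed.
Lemma kmapM t1 t2 t3 (b : larr t2 t3) (a : larr t1 t2) x :
  kmap (lcmp b a) x = kmap b (kmap a x).
Proof. by apply: mincl_inj; rewrite !kmapE /= pmapM. Qed.
Definition kpro : pro k :=
  @Pro k lvlCat lvl_cof (fun t => mker (lmap t)) kmap kmap1 kmapM.

Lemma kin_ex i : exists (t : lvl) (u : arr (lsrc t) i), True.
Proof.
have [j] := cof_inh (idx_cof Y); have [i0 [p e]] := lvl_rep j.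
have [l [a [b _]]] := idx_cone2 i0 i.
by exists (Lvl (cls_pmap a e)), b.
Qed.

Definition kincl (t : idx kpro) : {linear kpro t -> X (lsrc t)} := mincl (lmap t).
Definition kcls i (t : lvl) (u : arr (lsrc t) i) : colim kpro (X i) :=
  @cls k kpro (X i) t (pmap X u \o kincl t).

Lemma kcls_indep i t u t' u' : @kcls i t u = @kcls i t' u'.
Proof.
have [t2 [a [a' _]]] := cof_cone lvl_cof t t'.
have [m [w W]] := cof_eq (idx_cof X) (cmp u (asrc a)) (cmp u' (asrc a')).
have [t3 [b [e E]]] := lvl_dom w; subst m; rewrite /= in E; subst w.
apply/(clsP (X := kpro)); exists t3, (lcmp a b), (lcmp a' b) => x /=.
by rewrite !kmapE /= -!pmapM !cmpA W.
Qed.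

Definition kin : prohom kpro X.
Proof.
exists (fun i => let: exist t H := cid (kin_ex i) in let: exist u _ := cid H in kcls u).
move=> i i' v; case: cid => t H; case: cid => u _; case: cid => t' H'; case: cid => u' _.
rewrite pushE -(kcls_indep (cmp v u)); apply: cls_ext => x /=.
by rewrite pmapM.
Defined.

Lemma kinE i (t : lvl) (u : arr (lsrc t) i) : kin i = kcls u.
Proof. by rewrite /=; case: cid => t' H; case: cid => u' _; exact: kcls_indep. Qed.

Lemma kin_src (t : lvl) : kin (lsrc t) = @cls k kpro _ t (kincl t).
Proof. by rewrite (kinE (idm _)); apply: cls_ext => x /=; rewrite pmap1. Qed.

Definition kernel_of : kernel f.
Proof.
exists kpro kin.
  apply: prohom_ext => j /=; have [i [p e]] := lvl_rep j.
  rewrite -e pullE (kin_src (Lvl e)) pushE (cls0 _ (Lvl e : idx kpro)).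
  by apply: cls_ext => x /=; exact: mincl0.
move=> W h fh0.
have /dchoice[l lE] (t : lvl) : exists c : colim W (mker (lmap t)),
    push (mincl _) c = h (lsrc t).
  have : push (lmap t) (h (lsrc t)) = 0.
    by rewrite -pullE lvlP -[LHS]/((f \po h) _) fh0.
  have [w [g ->]] := clsW (h (lsrc t)); rewrite pushE => /cls_eq0[w' [u e]].
  have [g' g'E] := @mker_lift _ _ _ (lmap t) _ (g \o pmap W u) e.
  by exists (cls g'); rewrite pushE (cls_pull u g); exact: cls_ext.
have lc (t t' : idx kpro) (a : arr t t') : push (pmap kpro a) (l t) = l t'.
  apply: (push_inj (@mincl_inj _ _ _ _)); rewrite push_comp lE -(pcompat h (asrc a)) -lE.
  by rewrite push_comp; apply: eq_push => x /=; exact: kmapE.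
exists (@ProHom k W kpro l lc); split.
- apply: prohom_ext => i; have [t [u _]] := kin_ex i.
  rewrite [LHS]/(pull _ (kin i)) (kinE u).
  rewrite [LHS](pullE (ProHom lc) (pmap X u \o kincl t)).
  by rewrite -(pcompat h u) -lE push_comp; exact: eq_push.
- move=> l' l'E; apply: prohom_ext => t /=; apply: (push_inj (@mincl_inj _ _ _ _)).
  rewrite lE -l'E [LHS]/(pull l' (kin _)) kin_src.
  exact: (pullE l' (kincl t)).
Qed.

Lemma cmap_ex t t' (a : larr t t') :
  exists l : {linear mcoker (lmap t) -> mcoker (lmap t')},
    forall x, l (mproj _ x) = mproj _ (pmap Y (atgt a) x).
Proof.
apply: (mcoker_desc (h := mproj _ \o pmap Y (atgt a))) => x /=.
by rewrite -larrP [LHS]mproj0.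
Qed.
Definition cmap t t' (a : larr t t') : {linear mcoker (lmap t) -> mcoker (lmap t')} := sval (cid (cmap_ex a)).
Lemma cmapE t t' (a : larr t t') x : cmap a (mproj _ x) = mproj _ (pmap Y (atgt a) x).
Proof. by rewrite /cmap; case: cid. Qed.

Lemma cmap1 t x : cmap (lid t) x = x.
Proof.
suff -> : cmap (lid t) = idfun :> {linear _ -> _} by [].
by apply: mcoker_ext => y; rewrite cmapE /= pmap1.
Qed.
Lemma cmapM t1 t2 t3 (b : larr t2 t3) (a : larr t1 t2) x :
  cmap (lcmp b a) x = cmap b (cmap a x).
Proof.
suff -> : cmap (lcmp b a) = (cmap b \o cmap a) :> {linear _ -> _} by [].
by apply: mcoker_ext => y; rewrite /= !cmapE /= pmapM.
Qed.
Definition cpro : pro k :=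
  @Pro k lvlCat lvl_cof (fun t => mcoker (lmap t)) cmap cmap1 cmapM.

Definition cout : prohom Y cpro.
Proof.
exists (fun t : lvl => cls (mproj (lmap t))) => t t' a.
rewrite pushE [RHS](cls_pull (atgt a)); apply: cls_ext => x; exact: cmapE.
Defined.

Lemma cout_inj (N : lmodType k) (c d : colim cpro N) :
  pull cout c = pull cout d -> c = d.
Proof.
move=> cd; apply/eqP; rewrite -subr_eq0.
have {cd} : pull cout (c - d) = 0 by rewrite linearB /= cd subrr.
move: (c - d) => {c d} c; have [t [g ->]] := clsW c.
rewrite pullE pushE => /cls_eq0[j [w e]].
have [t' [a [E aE]]] := lvl_cod w; subst j; rewrite /= in aE; subst w.
apply/eqP/cls_eq0; exists t', a => x.
suff H : g \o cmap a = \0 :> {linear _ -> _} by exact: (congr1 (fun F : {linear _ -> _} => F x) H).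
by apply: mcoker_ext => y /=; rewrite cmapE; exact: e.
Qed.

Definition cokernel_of : cokernel f.
Proof.
exists cpro cout.
  apply: prohom_ext => t; rewrite [LHS]pullE -(lvlP t) pushE [RHS](cls0 _ (lsrc t)).
  by apply: cls_ext => x; exact: mproj0.
move=> W h hf0.
have /dchoice[l lE] w : exists c : colim cpro (W w), pull cout c = h w.
  have : pull f (h w) = 0 by rewrite -[LHS]/((h \po f) w) hf0.
  have [j [g ->]] := clsW (h w); have [i [p e]] := lvl_rep j.
  rewrite pullE -e pushE => /cls_eq0[i' [u E]].
  pose t := Lvl (cls_pmap u e).
  have [l lE] := @mcoker_desc _ _ _ (lmap t) _ g E.
  by exists (@cls k cpro _ t l); rewrite pullE pushE; exact: cls_ext.
have lc w w' (v : arr w w') : push (pmap W v) (l w) = l w'.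
  by apply: cout_inj; rewrite -pull_push !lE pcompat.
exists (ProHom lc); split; first by apply: prohom_ext => w; exact: lE.
move=> l' l'E; apply: prohom_ext => w; apply: cout_inj.
by rewrite /= lE -l'E.
Qed.
End Level.

Section Coproduct.
Variables (k : comPzRingType) (S : Type) (P : S -> pro k).

Definition prodCat : smallCat.
Proof.
exists (forall s, idx (P s)) (fun a b => forall s, arr (a s) (b s))
  (fun a s => idm (a s)) (fun a b c v u s => cmp (v s) (u s)) => *;
  apply: functional_extensionality_dep => s; rewrite ?(cmp1m, cmpm1) //; exact: cmpA.
Defined.

Lemma prod_cof : cofiltrant prodCat.
Proof.
split.
- have [g _] := @dchoice S (fun s => idx (P s)) (fun _ _ => True) (fun s =>
    let: inhabits i := cof_inh (idx_cof (P s)) in ex_intro (fun=> True) i I).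
  by split.
- move=> a b; have [c /dchoice[u /dchoice[v _]]] := dchoice (fun s =>
    cof_cone (idx_cof (P s)) (a s) (b s)).
  by exists c, u, v.
- move=> a b u v; have [c /dchoice[w E]] := dchoice (fun s =>
    cof_eq (idx_cof (P s)) (u s) (v s)).
  by exists c, w; exact: functional_extensionality_dep.
Qed.

Definition sob (a : prodCat) : lmodType k := msum (fun s => P s (a s)).
Definition sinl (a : prodCat) s : {linear P s (a s) -> sob a} :=
  msum_in (fun s => P s (a s)) s.
Lemma sinl_ext a (N : lmodType k) (f g : {linear sob a -> N}) :
  (forall s x, f (sinl a s x) = g (sinl a s x)) -> f = g.
Proof. exact: msum_ext. Qed.

Lemma smap_ex (a b : prodCat) (u : arr a b) : exists l : {linear sob a -> sob b},
  forall s x, l (sinl a s x) = sinl b s (pmap (P s) (u s) x).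
Proof. exact: (msum_desc (fun s => sinl b s \o pmap (P s) (u s))). Qed.
Definition smap (a b : prodCat) (u : arr a b) : {linear sob a -> sob b} := sval (cid (smap_ex u)).
Lemma smapE (a b : prodCat) (u : arr a b) s x :
  smap u (sinl a s x) = sinl b s (pmap (P s) (u s) x).
Proof. by rewrite /smap; case: cid. Qed.

Lemma smap1 (a : prodCat) x : smap (idm a) x = x.
Proof.
suff -> : smap (idm a) = idfun :> {linear _ -> _} by [].
by apply: sinl_ext => s y; rewrite smapE /= pmap1.
Qed.
Lemma smapM (a b c : prodCat) (v : arr b c) (u : arr a b) x :
  smap (cmp v u) x = smap v (smap u x).
Proof.
suff -> : smap (cmp v u) = (smap v \o smap u) :> {linear _ -> _} by [].
by apply: sinl_ext => s y; rewrite /= !smapE /= pmapM.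
Qed.
Definition spro : pro k := @Pro k prodCat prod_cof sob smap smap1 smapM.

Definition sin s : prohom (P s) spro.
Proof.
exists (fun a : prodCat => cls (sinl a s)) => a b u.
rewrite pushE [RHS](cls_pull (u s)); apply: cls_ext => x; exact: smapE.
Defined.

Lemma sin_inj (N : lmodType k) (c d : colim spro N) :
  (forall s, pull (sin s) c = pull (sin s) d) -> c = d.
Proof.
move=> cd; apply/eqP; rewrite -subr_eq0.
have {cd} : forall s, pull (sin s) (c - d) = 0 by move=> s; rewrite linearB /= cd subrr.
move: (c - d) => {c d} c; have [a [g ->]] := clsW c => g0.
have /dchoice[b /dchoice[u E]] s : exists b (u : arr b (a s)),
    forall x, g (sinl a s (pmap (P s) u x)) = 0.
  by have := g0 s; rewrite pullE pushE => /cls_eq0.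
apply/eqP/cls_eq0; exists (b : idx spro), u => x.
suff H : g \o smap u = \0 :> {linear _ -> _} by exact: (congr1 (fun F : {linear _ -> _} => F x) H).
by apply: sinl_ext => s y /=; rewrite smapE; exact: E.
Qed.

Definition coproduct_of : coproduct P.
Proof.
exists spro sin => W h.
have /dchoice[l lE] w : exists c : colim spro (W w), forall s, pull (sin s) c = h s w.
  have /dchoice[a /dchoice[g gE]] s := clsW (h s w).
  have [l lE] := msum_desc g.
  by exists (@cls k spro _ a l) => s; rewrite gE pullE pushE;
    apply: cls_ext => x; rewrite -[RHS]lE.
have lc w w' (v : arr w w') : push (pmap W v) (l w) = l w'.
  by apply: sin_inj => s; rewrite -pull_push !lE pcompat.
exists (ProHom lc); split; first by move=> s; apply: prohom_ext => w; exact: lE.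
move=> l' l'E; apply: prohom_ext => w; apply: sin_inj => s.
by rewrite /= lE -l'E.
Qed.
End Coproduct.

Section UniversalMaps.
Variable k : comPzRingType.
Implicit Types X Y W : pro k.

Lemma ker_monic X Y (f : prohom X Y) (K : kernel f) W (g h : prohom W (ker_obj K)) :
  ker_in K \po g = ker_in K \po h -> g = h.
Proof.
move=> gh; have [|l [_ lU]] := @ker_univ _ _ _ _ K W (ker_in K \po g).
  by rewrite pcompoA ker_in0 pcomp0o.
by rewrite -(lU g erefl); apply: lU; rewrite gh.
Qed.

Lemma cok_epic X Y (f : prohom X Y) (C : cokernel f) W (g h : prohom (cok_obj C) W) :
  g \po cok_out C = h \po cok_out C -> g = h.
Proof.
move=> gh; have [|l [_ lU]] := @cok_univ _ _ _ _ C W (g \po cok_out C).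
  by rewrite -pcompoA cok_out0 pcompo0.
by rewrite -(lU g erefl); apply: lU; rewrite gh.
Qed.

Lemma cop_epic (S : Type) (P : S -> pro k) (C : coproduct P) W
  (g h : prohom (cop_obj C) W) :
  (forall s, g \po cop_in C s = h \po cop_in C s) -> g = h.
Proof.
move=> gh; have [l [_ lU]] := @cop_univ _ _ _ C W (fun s => g \po cop_in C s).
by rewrite -(lU g (fun=> erefl)); apply: lU => s; rewrite gh.
Qed.

Definition ker_lift X Y (f : prohom X Y) (K : kernel f) W (h : prohom W X)
  (h0 : f \po h = 0) : prohom W (ker_obj K) := sval (cid (ker_univ K h0)).

Lemma ker_liftK X Y (f : prohom X Y) (K : kernel f) W (h : prohom W X)
  (h0 : f \po h = 0) : ker_in K \po ker_lift K h0 = h.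
Proof. by rewrite /ker_lift; case: cid => l []. Qed.

Definition cok_desc X Y (f : prohom X Y) (C : cokernel f) W (h : prohom Y W)
  (h0 : h \po f = 0) : prohom (cok_obj C) W := sval (cid (cok_univ C h0)).

Lemma cok_descK X Y (f : prohom X Y) (C : cokernel f) W (h : prohom Y W)
  (h0 : h \po f = 0) : cok_desc C h0 \po cok_out C = h.
Proof. by rewrite /cok_desc; case: cid => l []. Qed.

Definition pro_iso X Y (f : prohom X Y) : Prop :=
  exists g : prohom Y X, g \po f = pid X /\ f \po g = pid Y.

Definition oneCat : smallCat.
Proof. by exists unit (fun _ _ => unit) (fun=> tt) (fun _ _ _ _ _ => tt) => [? ? []|? ? []|]. Defined.

Lemma one_cof : cofiltrant oneCat.
Proof. by split=> [|[] []|[] [] [] []]; [split; exact: tt|exists tt, tt, tt|exists tt, tt]. Qed.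

(* The embedding of Mod(k) in Pro(k). *)
Definition cst (N : lmodType k) : pro k :=
  @Pro k oneCat one_cof (fun=> N) (fun _ _ _ => idfun) (fun _ _ => erefl)
    (fun _ _ _ _ _ _ => erefl).

Definition cst_map (N N' : lmodType k) (f : {linear N -> N'}) :
  prohom (cst N) (cst N').
Proof.
exists (fun j => @cls k (cst N) N' tt f) => j j' v.
by rewrite pushE; exact: cls_ext.
Defined.

Definition pro0 : pro k := cst 'rV[k]_0.

Definition zero_object X : Prop := pid X = 0.

End UniversalMaps.

Section Tensor.
Variable k : comPzRingType.
Implicit Types P N : pro k.
Implicit Types M G : lmodType k.

(* By naturality tadj f m = f \po u m with u = tadj (pid _), so that the
   bijections are automatically k-linear; see tens_adjP. *)
Record tensor (P : pro k) (M : lmodType k) := Tensor {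
  tobj : pro k;
  tadj : forall N, prohom tobj N -> {linear M -> prohom P N};
  tadj_bij : forall N, bijective (@tadj N);
  tadj_nat : forall N N' (h : prohom N N') (f : prohom tobj N) m,
    tadj (h \po f) m = h \po tadj f m }.

(* The cokernel of a map between coproducts of copies of P, given by the linear
   relations between the elements of M. *)
Definition tensor_of P M : tensor P M.
Proof.
pose C := coproduct_of (fun _ : M => P); pose i := cop_in C.
pose R := coproduct_of (fun _ : k * M * M => P).
have [rho [rhoE _]] := cid (cop_univ R (fun r : k * M * M =>
  r.1.1 *: i r.1.2 + i r.2 - i (r.1.1 *: r.1.2 + r.2))).
pose q := cok_out (cokernel_of rho).
have relE N (f : prohom (cop_obj C) N) a x y :
    f \po (a *: i x + i y - i (a *: x + y)) =
    a *: (f \po i x) + f \po i y - f \po i (a *: x + y).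
  by rewrite -[- i _]scaleN1r addrC !pcompoPl scaleN1r addrC.
have ulin N (f : prohom (cok_obj (cokernel_of rho)) N) :
    linear (fun m => (f \po q) \po i m).
  move=> a x y; apply/eqP; rewrite eq_sym -subr_eq0 -relE -(rhoE (a, x, y)).
  by rewrite pcompoA -(pcompoA f) cok_out0 pcompo0 pcomp0o.
have adj_inj N : injective (fun f => mklin (@ulin N f)).
  move=> f g fg; apply: (cok_epic (C := cokernel_of rho)).
  apply: (cop_epic (C := C)) => m.
  exact: (congr1 (fun F : {linear M -> prohom P N} => F m) fg).
have adj_surj N (g : {linear M -> prohom P N}) : exists f, mklin (@ulin N f) = g.
  have [h [hE _]] := cop_univ C g.
  have h0 : h \po rho = 0.
    apply: (cop_epic (C := R)) => -[[a x] y]; rewrite pcomp0o -pcompoA rhoE /= relE.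
    by rewrite !hE linearP subrr.
  have [f [fE _]] := cok_univ (cokernel_of rho) h0.
  by exists f; apply: linear_ext => m /=; rewrite fE hE.
exists (cok_obj (cokernel_of rho)) (fun N f => mklin (@ulin N f)).
- move=> N; pose inv g := sval (cid (adj_surj N g)).
  have invK g : mklin (ulin N (inv g)) = g by rewrite /inv; case: cid.
  by exists inv => // f; apply: adj_inj; rewrite invK.
- by move=> N N' h f m /=; rewrite !pcompoA.
Qed.

Definition tens P M : pro k := tobj (tensor_of P M).

Definition tens_adj P M N (f : prohom (tens P M) N) : {linear M -> prohom P N} :=
  tadj f.

Lemma tens_adj_inj P M N : injective (@tens_adj P M N).
Proof. exact: bij_inj (tadj_bij _ _). Qed.

Lemma tens_adj_surj P M N (g : {linear M -> prohom P N}) :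
  exists f, tens_adj f = g.
Proof.
have [inv _ invK] := @tadj_bij _ _ (tensor_of P M) N.
by exists (inv g); exact: invK.
Qed.

Definition tens_map_adj P P' M M' (f : prohom P P') (g : {linear M -> M'}) (m : M) :
  prohom P (tens P' M') := tens_adj (pid _) (g m) \po f.

Lemma tens_map_adj_linear P P' M M' (f : prohom P P') (g : {linear M -> M'}) :
  linear (tens_map_adj f g).
Proof. by move=> a x y; rewrite /tens_map_adj !linearP pcompoPr. Qed.

(* The functoriality of tens, determined by the naturality of tens_adj in its
   two arguments; see tens_adj_map. *)
Definition tens_map P P' M M' (f : prohom P P') (g : {linear M -> M'}) :
  prohom (tens P M) (tens P' M') :=
  sval (cid (tens_adj_surj (mklin (tens_map_adj_linear f g)))).

Lemma tens_adjE P M N (h : prohom (tens P M) N) m :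
  tens_adj h m = h \po tens_adj (pid _) m.
Proof. by rewrite -[in LHS](pcompo1 h); exact: tadj_nat. Qed.

Lemma tens_adjP P M N a (f g : prohom (tens P M) N) m :
  tens_adj (a *: f + g) m = a *: tens_adj f m + tens_adj g m.
Proof. by rewrite tens_adjE pcompoPr -!tens_adjE. Qed.

Lemma tens_adj_comp P M N N' (h : prohom N N') (f : prohom (tens P M) N) m :
  tens_adj (h \po f) m = h \po tens_adj f m.
Proof. exact: tadj_nat. Qed.

Lemma tens_adj_map P P' M M' (f : prohom P P') (g : {linear M -> M'}) N
  (h : prohom (tens P' M') N) m :
  tens_adj (h \po tens_map f g) m = tens_adj h (g m) \po f.
Proof.
rewrite tens_adj_comp /tens_map; case: cid => t /= ->.
by rewrite /= /tens_map_adj pcompoA -tens_adjE.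
Qed.

Lemma tens_mapM P P' P'' M M' M'' (f' : prohom P' P'') (f : prohom P P')
  (g' : {linear M' -> M''}) (g : {linear M -> M'}) :
  tens_map f' g' \po tens_map f g = tens_map (f' \po f) (g' \o g).
Proof.
apply: tens_adj_inj; apply: linear_ext => m; rewrite tens_adj_map.
rewrite -[tens_map f' g']pcomp1o -[tens_map (_ \po _) _]pcomp1o.
by rewrite !tens_adj_map pcompoA.
Qed.

Lemma tens_map1 P M (g : {linear M -> M}) : g =1 id -> tens_map (pid P) g = pid (tens P M).
Proof.
move=> gid; apply: tens_adj_inj; apply: linear_ext => m.
by rewrite -[tens_map _ _]pcomp1o tens_adj_map gid pcompo1.
Qed.

Lemma tens_map0r P P' M M' (f : prohom P P') (g : {linear M -> M'}) :
  (forall m, g m = 0) -> tens_map f g = 0.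
Proof.
move=> g0; apply: tens_adj_inj; apply: linear_ext => m.
by rewrite -[tens_map _ _]pcomp1o tens_adj_map g0 linear0 pcomp0o tens_adjE pcomp0o.
Qed.

Lemma tens_map0l P P' M M' (g : {linear M -> M'}) :
  tens_map (0 : prohom P P') g = 0.
Proof.
apply: tens_adj_inj; apply: linear_ext => m.
by rewrite -[tens_map _ _]pcomp1o tens_adj_map pcompo0 tens_adjE pcomp0o.
Qed.

Lemma eq_tens_map P P' M M' (f : prohom P P') (g g' : {linear M -> M'}) :
  g =1 g' -> tens_map f g = tens_map f g'.
Proof. by move/linear_ext->. Qed.
End Tensor.

Section Complexes.
Variable k : comPzRingType.

Record complex := Complex {
  cob :> nat -> pro k;
  cd : forall n, prohom (cob n.+1) (cob n);
  cdd : forall n, cd n \po cd n.+1 = 0 }.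

Section Homology.
Variables (C : complex) (n : nat).

Definition prev_ob (C : complex) (n : nat) : pro k :=
  if n is m.+1 then C m else pro0 k.

Definition d_out (C : complex) (n : nat) : prohom (C n) (prev_ob C n) :=
  match n with 0 => 0 | m.+1 => cd C m end.

Lemma d_out_cd : d_out C n \po cd C n = 0.
Proof. by case: n => [|m] /=; rewrite ?pcomp0o ?cdd. Qed.

Definition cycles : kernel (d_out C n) := kernel_of (d_out C n).

Definition boundary : prohom (C n.+1) (ker_obj cycles) := ker_lift cycles d_out_cd.

(* Coker (C_(n+1) -> Ker (C_n -> C_(n-1))), where C_(-1) = 0. *)
Definition homology : pro k := cok_obj (cokernel_of boundary).

Definition homology_class : prohom (ker_obj cycles) homology :=
  cok_out (cokernel_of boundary).
End Homology.

Record chain_map (C D : complex) := ChainMap {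
  cm :> forall n, prohom (C n) (D n);
  cmP : forall n, cd D n \po cm n.+1 = cm n \po cd C n }.

Section HomologyMap.
Variables (C D : complex) (c : chain_map C D) (n : nat).

Definition prev_map (n : nat) : prohom (prev_ob C n) (prev_ob D n) :=
  match n with 0 => 0 | m.+1 => c m end.

Lemma prev_mapP : d_out D n \po c n = prev_map n \po d_out C n.
Proof. by case: n => [|m] /=; rewrite ?pcomp0o // cmP. Qed.

Lemma cycles_map_subproof : d_out D n \po (c n \po ker_in (cycles C n)) = 0.
Proof. by rewrite pcompoA prev_mapP -pcompoA ker_in0 pcompo0. Qed.

Definition cycles_map : prohom (ker_obj (cycles C n)) (ker_obj (cycles D n)) :=
  ker_lift (cycles D n) cycles_map_subproof.

Lemma homology_map_subproof :
  (homology_class D n \po cycles_map) \po boundary C n = 0.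
Proof.
suff E : cycles_map \po boundary C n = boundary D n \po c n.+1.
  by rewrite -pcompoA E pcompoA cok_out0 pcomp0o.
apply: (ker_monic (K := cycles D n)).
by rewrite !pcompoA !ker_liftK -pcompoA ker_liftK cmP.
Qed.

Definition homology_map : prohom (homology C n) (homology D n) :=
  cok_desc (cokernel_of (boundary C n)) homology_map_subproof.
End HomologyMap.

(* C_0 being followed by 0, this includes that C_1 -> C_0 is an epimorphism. *)
Definition exact_seq (C : complex) : Prop := forall n, zero_object (homology C n).

Section Augmented.
Variables (M : pro k) (C : complex) (e : prohom (C 0) M) (e0 : e \po cd C 0 = 0).

Definition aug_ob (n : nat) : pro k := if n is m.+1 then C m else M.
Definition aug_d (n : nat) : prohom (aug_ob n.+1) (aug_ob n) :=
  match n with 0 => e | m.+1 => cd C m end.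
Lemma aug_dd n : aug_d n \po aug_d n.+1 = 0.
Proof. by case: n => [|n] //=; rewrite cdd. Qed.

Definition augmented : complex := Complex aug_dd.
End Augmented.

End Complexes.

Section Resolutions.
Variable k : comPzRingType.

(* f and g are plain functions so that the notion applies as such to the maps
   induced on modules of morphisms. *)
Definition short_exact (A B C : lmodType k) (f : A -> B) (g : B -> C) : Prop :=
  [/\ injective f, forall y, g y = 0 <-> exists x, f x = y
    & forall z, exists y, g y = z].

Definition quasi_projective (P : pro k) : Prop :=
  forall (A B C : lmodType k) (f : {linear A -> B}) (g : {linear B -> C}),
  short_exact f g ->
  short_exact (fun h : prohom P (cst A) => cst_map f \po h)
              (fun h : prohom P (cst B) => cst_map g \po h).

Definition injective_mod (J : lmodType k) : Prop :=
  forall (U V : lmodType k) (i : {linear U -> V}), injective i ->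
  forall f : {linear U -> J}, exists g : {linear V -> J}, forall x, g (i x) = f x.

Definition projective_mod (Q : lmodType k) : Prop :=
  forall (U V : lmodType k) (p : {linear U -> V}), (forall y, exists x, p x = y) ->
  forall f : {linear Q -> V}, exists g : {linear Q -> U}, forall x, p (g x) = f x.

Record qp_resolution (M : pro k) := QpResolution {
  qp_cx :> complex k;
  qp_aug : prohom (qp_cx 0) M;
  qp_aug0 : qp_aug \po cd qp_cx 0 = 0;
  qp_exact : exact_seq (augmented qp_aug0);
  qp_qproj : forall n, quasi_projective (qp_cx n) }.

Record proj_resolution (G : lmodType k) := ProjResolution {
  pr_ob :> nat -> lmodType k;
  pr_d : forall n, {linear pr_ob n.+1 -> pr_ob n};
  pr_aug : {linear pr_ob 0 -> G};
  pr_aug_surj : forall y, exists x, pr_aug x = y;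
  pr_exact0 : forall x, pr_aug x = 0 <-> exists y, pr_d 0 y = x;
  pr_exact : forall n x, pr_d n x = 0 <-> exists y, pr_d n.+1 y = x;
  pr_proj : forall n, projective_mod (pr_ob n) }.

Record qp_map (M M' : pro k) (f : prohom M M') (P : qp_resolution M)
  (P' : qp_resolution M') := QpMap {
  qp_cm :> chain_map P P';
  qp_mapP : qp_aug P' \po qp_cm 0 = f \po qp_aug P }.

Record pr_map (G G' : lmodType k) (g : {linear G -> G'}) (Q : proj_resolution G)
  (Q' : proj_resolution G') := PrMap {
  pr_cm :> forall n, {linear Q n -> Q' n};
  pr_cmP : forall n x, pr_d Q' n (pr_cm n.+1 x) = pr_cm n (pr_d Q n x);
  pr_mapP : forall x, pr_aug Q' (pr_cm 0 x) = g (pr_aug Q x) }.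

Section TensorComplexes.
Variables (G : lmodType k).

Lemma tens_complexl_dd (P : complex k) n :
  tens_map (cd P n) (idfun : {linear G -> G}) \po tens_map (cd P n.+1) idfun = 0.
Proof. by rewrite tens_mapM cdd tens_map0l. Qed.

Definition tens_complexl (P : complex k) : complex k :=
  Complex (@tens_complexl_dd P).

Variables (M : pro k) (Q : proj_resolution G).

Lemma tens_complexr_dd n :
  tens_map (pid M) (pr_d Q n) \po tens_map (pid M) (pr_d Q n.+1) = 0.
Proof.
by rewrite tens_mapM tens_map0r // => x /=; apply/pr_exact; exists x.
Qed.

Definition tens_complexr : complex k := Complex tens_complexr_dd.

Definition Tor (n : nat) : pro k := homology tens_complexr n.
End TensorComplexes.

Section TensorMaps.
Variables (G G' : lmodType k) (g : {linear G -> G'}).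

Lemma tens_chain_mapl_subproof (P P' : complex k) (p : chain_map P P') n :
  cd (tens_complexl G' P') n \po tens_map (p n.+1) g =
  tens_map (p n) g \po cd (tens_complexl G P) n.
Proof. by rewrite /= !tens_mapM cmP; exact: eq_tens_map. Qed.

Definition tens_chain_mapl (P P' : complex k) (p : chain_map P P') :
  chain_map (tens_complexl G P) (tens_complexl G' P') :=
  @ChainMap k (tens_complexl G P) (tens_complexl G' P')
    (fun n => tens_map (p n) g) (tens_chain_mapl_subproof p).

Variables (M M' : pro k) (f : prohom M M').
Variables (Q : proj_resolution G) (Q' : proj_resolution G') (q : pr_map g Q Q').

Lemma tens_chain_mapr_subproof n :
  cd (tens_complexr M' Q') n \po tens_map f (q n.+1) =
  tens_map f (q n) \po cd (tens_complexr M Q) n.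
Proof.
rewrite /= !tens_mapM pcomp1o pcompo1; apply: eq_tens_map => x /=.
exact: pr_cmP.
Qed.

Definition tens_chain_mapr : chain_map (tens_complexr M Q) (tens_complexr M' Q') :=
  @ChainMap k (tens_complexr M Q) (tens_complexr M' Q')
    (fun n => tens_map f (q n)) tens_chain_mapr_subproof.

Definition Tor_map (n : nat) : prohom (Tor M Q n) (Tor M' Q' n) :=
  homology_map tens_chain_mapr n.
End TensorMaps.

End Resolutions.

Definition quasi_noetherian (k : comPzRingType) : Prop :=
  forall P : pro k, quasi_projective P ->
  forall J : lmodType k, injective_mod J -> injective_mod (prohom P (cst J)).

(* Main.v *)
From HB Require Import structures.
From mathcomp Require Import all_boot all_algebra boolp classical_sets.
Require Import Defs.

(* Let Tot be the total complex of the double complex P_p (x) Q_q.  The augmentations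
   Q_0 -> G and P_0 -> M induce chain maps Tot -> P (x) G and Tot -> M (x) Q, natural in
   all the data; both are quasi-isomorphisms, and theta is the second one composed with
   the inverse of the first one in homology.  Since injective modules J cogenerate Mod(k),
   isomorphisms in Pro(k) are detected by the functors Hom(-, J), and these turn homology
   into cohomology; it remains to chase elements in the double complex
   Hom(P_p (x) Q_q, J) = Hom(Q_q, Hom(P_p, J)).  It is exact in the direction of p because
   Q_q is projective, and in the direction of q because Hom(P_p, J) is injective, which is
   where k has to be quasi-noetherian. *)

Set Implicit Arguments.
Unset Strict Implicit.
Unset Printing Implicit Defensive.

Import GRing.Theory Num.Theory.
Local Open Scope ring_scope.
Local Open Scope quotient_scope.

(** * Enough injectives *)

Definition mkadd (U V : zmodType) (f : U -> V) (Hf : zmod_morphism f) :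
  {additive U -> V} := HB.pack f (GRing.isZmodMorphism.Build U V f Hf).

(** Euclidean division by the least positive element of H leaves remainder 0; if no element is
    positive, H is zero and m = 0. *)
Lemma int_subgroup_principal (H : int -> Prop) :
  H 0 -> (forall m n, H m -> H n -> H (m - n)) ->
  exists2 m : nat, H m%:Z & forall n, H n -> exists q, n = q * m%:Z.
Proof.
move=> H0 HB.
have HN n : H n -> H (- n) by move=> Hn; rewrite -sub0r; exact: HB.
have HM (q : int) n : H n -> H (q * n).
  have HMn (j : nat) m : H m -> H (m *+ j).
    by move=> Hm; elim: j => [//|j IH]; rewrite mulrSr -[X in _ + X]opprK; apply/HB/HN.
  move=> Hn; case: q => j; first by rewrite -[Posz j]natz mulr_natl; exact: HMn.
  by rewrite NegzE mulNr -natz mulr_natl; apply/HN/HMn.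
have [[m /andP[m0 /asboolP Hm]]|none] := pselect (exists m : nat, (0 < m)%N && `[< H m%:Z >]).
  have ex : exists m : nat, (0 < m)%N && `[< H m%:Z >] by exists m; rewrite m0; apply/asboolP.
  case: (ex_minnP ex) => {}m /andP[{}m0 /asboolP {}Hm] min.
  exists m => // n Hn; exists (n %/ m)%Z.
  have Hr : H (n %% m)%Z.
    by rewrite -[(n %% m)%Z](addKr ((n %/ m)%Z * m)) -divz_eq addrC; exact/HB/HM.
  have m0' : m%:Z != 0 by rewrite eqz_nat -lt0n.
  have [r rE] : exists r : nat, (n %% m)%Z = r.
    by case: (n %% m)%Z (modz_ge0 n m0') => // r; exists r.
  have := ltz_pmod n (m0 : 0 < m%:Z); rewrite [n in n = _](divz_eq n m%:Z).
  rewrite {}rE in Hr *.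
  case: r Hr => [|r] Hr rm; first by rewrite addr0.
  by have := min r.+1 (introT (asboolP _) Hr); rewrite leqNgt -ltz_nat rm.
exists 0%N => // n Hn; exists 0; rewrite mul0r; apply: contrapT => n0; apply: none.
exists `|n|%N; rewrite absz_gt0; apply/andP; split; first exact/eqP.
by apply/asboolP; case: (ltrP n 0) => ?; [rewrite ltz0_abs //; exact: HN|rewrite gez0_abs].
Qed.

Definition divisible (D : zmodType) : Prop :=
  forall (d : D) (n : nat), (0 < n)%N -> exists e, e *+ n = d.

Section Extension.
Variables (V D : zmodType) (divD : divisible D).

(** The graph of a homomorphism to D from a subgroup of V. Extension is then inclusion of graphs,
    and a nonempty chain is bounded by its union. *)
Definition partial_hom (G : set (V * D)) : Prop :=
  [/\ G 0, forall p q, G p -> G q -> G (p - q) & forall d, G (0, d) -> d = 0].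

Lemma partial_hom_extend (G : set (V * D)) : partial_hom G -> forall v,
  exists G', [/\ partial_hom G', (G `<=` G')%classic & exists d, G' (v, d)].
Proof.
move=> [G0 GB Gf] v.
have GN p : G p -> G (- p) by move=> Gp; rewrite -sub0r; exact: GB.
have GD p q : G p -> G q -> G (p + q) by move=> Gp Gq; rewrite -[q]opprK; exact/GB/GN.
have GMn p (n : nat) : G p -> G (p *+ n).
  by move=> Gp; elim: n => [//|n IH]; rewrite mulrSr; exact: GD.
have GM p (n : int) : G p -> G (p *~ n).
  by case: n => n Gp; rewrite ?NegzE ?mulrNz -pmulrn; [exact: GMn|exact/GN/GMn].
have wM (x : V) (y : D) (n : int) : (x, y) *~ n = (x *~ n, y *~ n).
  have wMn (m : nat) : (x, y) *+ m = (x *+ m, y *+ m).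
    by elim: m => // m IH; rewrite !mulrSr IH.
  by case: n => n; rewrite ?NegzE ?mulrNz -!pmulrn wMn.
(* e will be the value at v. The multiples of v in the domain are those of m v; e is obtained by
   dividing the value at m v by m, as D is divisible, and is 0 when m = 0. *)
have [e eP] : exists e, forall (n : int) d, G (v *~ n, d) -> d = e *~ n.
  have [||m [d Gd] mP] := @int_subgroup_principal (fun n => exists d, G (v *~ n, d)).
  - by exists 0; rewrite mulr0z.
  - by move=> m n [d Gd] [d' Gd']; exists (d - d'); rewrite mulrzBr; exact: (GB _ _ Gd Gd').
  have uniq p d1 d2 : G (p, d1) -> G (p, d2) -> d1 = d2.
    move=> G1 G2; apply/eqP; rewrite -subr_eq0; apply/eqP/Gf.
    by rewrite -(subrr p); exact: (GB _ _ G1 G2).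
  have [m0|m0] := posnP m.
    exists 0 => n d' Gd'; have [|q] := mP n; first by exists d'.
    by rewrite m0 mulr0 => n0; move: Gd'; rewrite n0 !mulr0z; exact: Gf.
  have [e eE] := divD d m0; exists e => n d' Gd'.
  have [|q nq] := mP n; first by exists d'.
  apply: (uniq (v *~ n)) => //; rewrite nq [q * _]mulrC !mulrzA -[e *~ m]pmulrn eE.
  by rewrite -wM; exact: GM.
pose w : V * D := (v, e).
exists (fun p => exists n : int, exists2 q, G q & p = q + w *~ n); split.
- split.
  + by exists 0, 0 => //; rewrite mulr0z addr0.
  + move=> _ _ [m [p Gp ->]] [n [q Gq ->]]; exists (m - n), (p - q); first exact: GB.
    by rewrite mulrzBr opprD addrACA.
  + move=> d [n [[q1 q2] Gq]]; rewrite wM => -[/esym/eqP].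
    rewrite addr_eq0 -mulrNz => /eqP q1E ->; rewrite q1E in Gq.
    by rewrite (eP _ _ Gq) mulrNz addNr.
- by move=> p Gp; exists 0, p => //; rewrite mulr0z addr0.
- by exists e, 1, 0 => //; rewrite mulr1z add0r.
Qed.

(** By Zorn's lemma G lies in a maximal graph, whose domain is all of V since otherwise
    [partial_hom_extend] would enlarge it. *)
Lemma partial_hom_total (G : set (V * D)) : partial_hom G ->
  exists g : {additive V -> D}, forall p, G p -> p.2 = g p.1.
Proof.
move=> PG.
pose T := {A : set (V * D) | partial_hom A /\ (G `<=` A)%classic}.
have [|||[A [PA GA]] Amax] := @ZL_preorder T (exist _ G (conj PG (@subset_refl _ G)))
    (fun A B => `[< (sval A `<=` sval B)%classic >]).
- by move=> A; apply/asboolP.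
- by move=> A B C /asboolP AB /asboolP BC; apply/asboolP; exact: subset_trans BC.
(* The empty chain is bounded by G itself, as its union would not contain 0. *)
- move=> F totF; have [[A0 FA0]|F0] := pselect (exists A, F A); last first.
    by exists (exist _ G (conj PG (@subset_refl _ G))) => A FA; case: F0; exists A.
  pose B : set (V * D) := fun p => exists2 A, F A & sval A p.
  have PB : partial_hom B.
    split.
    - by exists A0 => //; have [[]] := svalP A0.
    - move=> p q [A1 F1 p1] [A2 F2 q2].
      have [/asboolP s|/asboolP s] := totF _ _ F1 F2.
        by exists A2 => //; have [[_ AB _] _] := svalP A2; apply: AB => //; exact: s.
      by exists A1 => //; have [[_ AB _] _] := svalP A1; apply: AB => //; exact: s.
    - by move=> d [A _]; have [[_ _ Af] _] := svalP A; exact: Af.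
  have GB : (G `<=` B)%classic.
    by move=> p Gp; exists A0 => //; have [_ GA0] := svalP A0; exact: GA0.
  by exists (exist _ B (conj PB GB)) => A FA; apply/asboolP => p Ap; exists A.
have [A0 AB Af] := PA.
have total v : exists d, A (v, d).
  have [A' [PA' AA' [d A'd]]] := partial_hom_extend PA v.
  have /asboolP := Amax (exist _ A' (conj PA' (subset_trans GA AA'))) (introT (asboolP _) AA').
  by move=> A'A; exists d; exact: A'A.
have uniq v d1 d2 : A (v, d1) -> A (v, d2) -> d1 = d2.
  move=> A1 A2; apply/eqP; rewrite -subr_eq0; apply/eqP/Af.
  by rewrite -(subrr v); exact: (AB _ _ A1 A2).
have [g gP] := dchoice total.
have gB : zmod_morphism g.
  by move=> x y; apply: (uniq (x - y)) => //; exact: (AB _ _ (gP x) (gP y)).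
by exists (mkadd gB) => -[v d] Gvd; apply: (uniq v); [exact: (GA _ Gvd)|exact: gP].
Qed.

(** The partial homomorphism to extend is f composed with the inverse of i, on the image of i. *)
Lemma divisible_injective (U : zmodType) (i : {additive U -> V}) (f : {additive U -> D}) :
  injective i -> exists g : {additive V -> D}, forall x, g (i x) = f x.
Proof.
move=> inj_i.
have [|g gP] := @partial_hom_total (fun p => exists x, p = (i x, f x)).
- split; first by exists 0; rewrite !raddf0.
    by move=> _ _ [x ->] [y ->]; exists (x - y); rewrite !raddfB.
  by move=> d [x [/esym/eqP]]; rewrite -(raddf0 i) => /eqP/inj_i -> ->; rewrite raddf0.
by exists g => x; have <- := gP (i x, f x); last by exists x.
Qed.
End Extension.

Definition integral_rat : {pred rat} := fun x => x \is a Num.int.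

Lemma integral_rat_zmod_closed : zmod_closed integral_rat.
Proof. by split=> [|x y]; rewrite !unfold_in; [exact: rpred0|exact: rpredB]. Qed.

HB.instance Definition _ :=
  GRing.isZmodClosed.Build rat integral_rat integral_rat_zmod_closed.

Definition rat_mod_int : zmodType := Quotient.quot integral_rat.

Lemma rat_mod_int_divisible : divisible rat_mod_int.
Proof.
move=> d n n0; exists (\pi_rat_mod_int (repr d / n%:R)).
by rewrite -raddfMn -[_ *+ n]mulr_natr divfK ?pnatr_eq0 -?lt0n //; exact: reprK.
Qed.

(** Let m be the order of a modulo the image of f, 0 if infinite; m is not 1. The character kills
    the image of f and sends a to the class of 1/m, or of 1/2 if m = 0; it extends to A because Q/Z
    is divisible. *)
Lemma rat_mod_int_separates (U A : zmodType) (f : {additive U -> A}) (a : A) :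
  ~ (exists x, f x = a) ->
  exists chi : {additive A -> rat_mod_int}, (forall x, chi (f x) = 0) /\ chi a != 0.
Proof.
move=> fa.
have [||m am mP] := @int_subgroup_principal (fun n => exists x, f x = a *~ n).
- by exists 0; rewrite raddf0 mulr0z.
- by move=> m n [x xm] [y yn]; exists (x - y); rewrite raddfB xm yn mulrzBr.
pose m' := if m == 0%N then 2 else m.
have m'2 : (1 < m')%N.
  rewrite /m'; case: eqP => // m0; rewrite ltn_neqAle lt0n eq_sym andbC.
  case: eqP => //= _; apply/eqP => m1; apply: fa.
  by have [x] := am; rewrite m1 => xa; exists x.
pose c : rat_mod_int := \pi_rat_mod_int (m'%:R^-1).
have pi0 r : (\pi_rat_mod_int r == 0) = (r \is a Num.int).
  by rewrite -(raddf0 (\pi_rat_mod_int)) -Quotient.idealrBE subr0.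
have c0 : c != 0.
  rewrite pi0; apply/negP => /intrP[z /(congr1 ( *%R^~ m'%:R)) ].
  rewrite mulVf ?pnatr_eq0 -?lt0n ?(ltnW m'2) // pmulrn -intrM -[1]/(1%:~R).
  move=> /intr_inj/(congr1 absz); rewrite abszM => /esym/eqP.
  by rewrite muln_eq1 => /andP[_ /eqP m1]; have := m'2; rewrite -[m']/`|m'%:Z|%N m1.
have cm : c *~ m = 0.
  rewrite /c /m'; case: eqP => [->|/eqP m0]; first by rewrite mulr0z.
  rewrite -pmulrn -raddfMn -[_ *+ m]mulr_natr mulVf ?pnatr_eq0 //; apply/eqP.
  by rewrite pi0; exact: rpred1.
have [|chi chiP] := @partial_hom_total A rat_mod_int rat_mod_int_divisible
    (fun p => exists (x : U) (n : int), p = (f x + a *~ n, c *~ n)).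
  split; first by exists 0, 0; rewrite raddf0 !mulr0z addr0.
    move=> _ _ [x1 [n1 ->]] [x2 [n2 ->]]; exists (x1 - x2), (n1 - n2).
    by rewrite raddfB !mulrzBr addrACA -opprD.
  move=> d [x1 [n1 [/esym/eqP]]]; rewrite addr_eq0 => /eqP fx ->.
  have [|q ->] := mP n1; last by rewrite mulrC mulrzA cm mul0rz.
  by exists (- x1); rewrite raddfN fx opprK.
exists chi; split=> [x|].
  have <- // := chiP (f x, 0).
  by exists x, 0; rewrite !mulr0z addr0.
have <- // := chiP (a, c).
by exists 0, 1; rewrite raddf0 add0r !mulr1z.
Qed.

Section Coinduced.
Variables (k : comPzRingType) (D : zmodType) (S : Type).

(* Hom_Z(k, D^S) *)
Record coind := Coind {
  coind_fun :> k -> S -> D;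
  coindB : forall s, zmod_morphism (coind_fun^~ s) }.
HB.instance Definition _ := gen_eqMixin coind.
HB.instance Definition _ := gen_choiceMixin coind.

Lemma coind_ext (f g : coind) : (forall a s, f a s = g a s) -> f = g.
Proof.
case: f g => f fB [g gB] /= fg.
have {fg} fg : f = g by apply/funext => a; apply/funext => s; exact: fg.
by move: fB gB; rewrite fg => fB gB; congr Coind; exact: Prop_irrelevance.
Qed.

Lemma coindD (f : coind) a b s : f (a + b) s = f a s + f b s.
Proof. exact: (raddfD (mkadd (coindB f s))). Qed.

Definition coind_zero : coind.
Proof. by exists (fun _ _ => 0) => s a b; rewrite subrr. Defined.
Definition coind_opp (f : coind) : coind.
Proof. by exists (fun a s => - f a s) => s a b; rewrite coindB opprB addrC opprK. Defined.
Definition coind_add (f g : coind) : coind.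
Proof. by exists (fun a s => f a s + g a s) => s a b; rewrite !coindB opprD addrACA. Defined.
Definition coind_scale (c : k) (f : coind) : coind.
Proof. by exists (fun a s => f (a * c) s) => s a b; rewrite mulrBl coindB. Defined.

Let addA : associative coind_add.
Proof. by move=> f g h; apply: coind_ext => a s /=; rewrite addrA. Qed.
Let addC : commutative coind_add.
Proof. by move=> f g; apply: coind_ext => a s /=; rewrite addrC. Qed.
Let add0 : left_id coind_zero coind_add.
Proof. by move=> f; apply: coind_ext => a s /=; rewrite add0r. Qed.
Let addN : left_inverse coind_zero coind_opp coind_add.
Proof. by move=> f; apply: coind_ext => a s /=; rewrite addNr. Qed.
HB.instance Definition _ := GRing.isZmodule.Build coind addA addC add0 addN.

Let scaleA b c f : coind_scale b (coind_scale c f) = coind_scale (b * c) f.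
Proof. by apply: coind_ext => a s /=; rewrite mulrA. Qed.
Let scale1 : left_id 1 coind_scale.
Proof. by move=> f; apply: coind_ext => a s /=; rewrite mulr1. Qed.
Let scaleDr : right_distributive coind_scale +%R.
Proof. by move=> c f g; apply: coind_ext. Qed.
Let scaleDl f : {morph coind_scale^~ f : b c / b + c}.
Proof. by move=> b c; apply: coind_ext => a s /=; rewrite mulrDr coindD. Qed.
HB.instance Definition _ :=
  GRing.Zmodule_isLmodule.Build k coind scaleA scale1 scaleDr scaleDl.

(** By evaluation at 1, a linear map from V to [coind] amounts to a family over S of additive maps
    from V to D, and these extend one by one. *)
Lemma coind_injective : divisible D -> injective_mod coind.
Proof.
move=> divD U V i inj_i f.
have fB s : zmod_morphism (fun u => f u 1 s) by move=> u v; rewrite raddfB.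
have /dchoice[g gE] s := divisible_injective divD (mkadd (fB s))
  (inj_i : injective (i : {additive U -> V})).
have gB v s : zmod_morphism (fun a => g s (a *: v)) by move=> a b; rewrite scalerBl raddfB.
have gL : linear (fun v => Coind (gB v)).
  by move=> c v w; apply: coind_ext => a s /=; rewrite scalerDr raddfD /= scalerA.
exists (mklin gL) => u; apply: coind_ext => a s /=.
have -> : g s (a *: i u) = g s (i (a *: u)) by rewrite linearZ.
by rewrite gE /= linearZ /= mul1r.
Qed.
End Coinduced.

(** There is one factor for each character of M that kills the image of f: q records the values of
    all of them, and they separate that image from the elements outside it. *)
Lemma injective_copresentation (k : comPzRingType) (N M : lmodType k) (f : {linear N -> M}) :
  exists (J : lmodType k) (q : {linear M -> J}),
    injective_mod J /\ forall y, q y = 0 <-> exists x, f x = y.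
Proof.
pose S := {chi : {additive M -> rat_mod_int} | forall x, chi (f x) = 0}.
have qB m : forall s : S, zmod_morphism (fun a : k => sval s (a *: m)).
  by move=> s a b; rewrite scalerBl raddfB.
have qL : linear (fun m => Coind (qB m)).
  by move=> c v w; apply: coind_ext => a s /=; rewrite scalerDr raddfD /= scalerA.
exists (coind k rat_mod_int S), (mklin qL); split.
  exact: coind_injective rat_mod_int_divisible.
move=> y; split=> [qy|[x <-]]; last first.
  by apply: coind_ext => a [chi chi0] /=; rewrite -linearZ.
apply: contrapT => fy; have [chi [chi0 /eqP]] := rat_mod_int_separates (f := f) fy; apply.
by have := congr1 (fun g : coind _ _ _ => g 1 (exist _ chi chi0)) qy; rewrite /= scale1r.
Qed.

Lemma enough_injectives (k : comPzRingType) (M : lmodType k) :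
  exists (J : lmodType k) (i : {linear M -> J}), injective_mod J /\ injective i.
Proof.
have [J [i [injJ i0]]] := injective_copresentation (\0 : {linear M -> M}).
exists J, i; split=> // x y xy; apply/eqP; rewrite -subr_eq0.
by have [|z <-] := (i0 (x - y)).1; rewrite ?linearB ?xy ?subrr.
Qed.

(** * Maps from pro-modules to injective modules *)

Section ModuleFactor.
Variable k : comPzRingType.
Implicit Types U V W J Q : lmodType k.

Lemma mproj_surj U V (f : {linear U -> V}) (c : mcoker f) : exists x, mproj f x = c.
Proof. exists (repr c); exact: tclK. Qed.

Lemma mincl_surj U V (f : {linear U -> V}) x : f x = 0 -> exists y, mincl f y = x.
Proof. by move=> /eqP fx; exists (MKer (fx : x \in in_ker f)). Qed.

(** l induces an injection into V from the quotient of U by the kernel of l, and phi descends to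
    this quotient, where injectivity of J applies. *)
Lemma injective_mod_factor J U V (l : {linear U -> V}) (phi : {linear U -> J}) :
  injective_mod J -> (forall x, l x = 0 -> phi x = 0) ->
  exists psi : {linear V -> J}, forall x, psi (l x) = phi x.
Proof.
move=> injJ l0.
have [|l' l'E] := @mcoker_desc _ _ _ (mincl l) _ l; first exact: mincl0.
have [|phi' phi'E] := @mcoker_desc _ _ _ (mincl l) _ phi.
  by move=> x; apply/l0/mincl0.
have inj_l' : injective l'.
  move=> c d cd; apply/eqP; rewrite -subr_eq0; apply/eqP.
  have {cd} : l' (c - d) = 0 by rewrite linearB cd subrr.
  have [x <-] := mproj_surj (c - d); rewrite l'E => lx.
  by have [y <-] := mincl_surj lx; exact: mproj0.
have [psi psiE] := injJ _ _ l' inj_l' phi'.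
by exists psi => x; rewrite -l'E psiE phi'E.
Qed.

(** The fibre product of U and Q over V, here the kernel of [d], maps onto Q by hypothesis, so
    projectivity gives a section. *)
Lemma projective_mod_lift Q U V (p : {linear U -> V}) (f : {linear Q -> V}) :
  projective_mod Q -> (forall m, exists u, p u = f m) ->
  exists g : {linear Q -> U}, forall m, p (g m) = f m.
Proof.
move=> projQ pf.
pose d : {linear (U * Q)%type -> V} := (p \o fst) \- (f \o snd).
have [m|g gE] := projQ _ _ (snd \o mincl d) _ idfun.
  have [u uE] := pf m; have [|y yE] := @mincl_surj _ _ d (u, m).
    by rewrite /= uE subrr.
  by exists y; exact: (congr1 snd yE).
exists (fst \o (mincl d \o g)) => m /=; apply/eqP; rewrite -subr_eq0 -{2}[m](gE m).
by apply/eqP; exact: (mincl0 (g m)).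
Qed.
End ModuleFactor.

Section ConstantTarget.
Variable k : comPzRingType.
Implicit Types X Y Z : pro k.

Definition to_cst X (N : lmodType k) (c : colim X N) : prohom X (cst N).
Proof. by exists (fun _ => c) => j j' v; apply: push_id. Defined.

Lemma cst_hom_ext X (N : lmodType k) (f g : prohom X (cst N)) : f tt = g tt -> f = g.
Proof. by move=> fg; apply: prohom_ext => -[]. Qed.

Lemma pcompoDl X Y Z (g : prohom Y Z) (f f' : prohom X Y) :
  g \po (f + f') = g \po f + g \po f'.
Proof. by have := pcompoPl g f f' 1; rewrite !scale1r. Qed.

Lemma pcompoDr X Y Z (g g' : prohom Y Z) (f : prohom X Y) :
  (g + g') \po f = g \po f + g' \po f.
Proof. by have := pcompoPr g g' f 1; rewrite !scale1r. Qed.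

Lemma pcompoZl X Y Z (g : prohom Y Z) (f : prohom X Y) a : g \po (a *: f) = a *: (g \po f).
Proof. by rewrite -[a *: f]addr0 pcompoPl pcompo0 addr0. Qed.

Lemma pcompoZr X Y Z (g : prohom Y Z) (f : prohom X Y) a : (a *: g) \po f = a *: (g \po f).
Proof. by rewrite -[a *: g]addr0 pcompoPr pcomp0o addr0. Qed.

Lemma pcompoNr X Y Z (g : prohom Y Z) (f : prohom X Y) : (- g) \po f = - (g \po f).
Proof. by rewrite -scaleN1r pcompoZr scaleN1r. Qed.

Lemma pcompoBr X Y Z (g g' : prohom Y Z) (f : prohom X Y) :
  (g - g') \po f = g \po f - g' \po f.
Proof. by rewrite pcompoDr pcompoNr. Qed.

(** As [kernel_of] is opaque, this relation serves to compare the concrete [kin f] with an abstract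
    kernel. *)
Lemma comp_kin X Y (f : prohom X Y) : f \po kin f = 0.
Proof.
apply: prohom_ext => j /=; have [i [p e]] := lvl_rep f j.
rewrite -e pullE (kin_src (Lvl e)) pushE (cls0 _ (Lvl e : idx (kpro f))).
by apply: cls_ext => x /=; exact: mincl0.
Qed.

(** phi is given by p on a single X_i. Far enough among the levels of f, p vanishes on the kernel of
    the linear map [lmap t'] representing f, hence factors through that map because J is
    injective. *)
Lemma injective_mod_extend X Y (f : prohom X Y) (K : kernel f) (J : lmodType k)
  (phi : prohom X (cst J)) : injective_mod J -> phi \po ker_in K = 0 ->
  exists psi : prohom Y (cst J), phi = psi \po f.
Proof.
move=> injJ phiK; have phi0 : phi \po kin f = 0.
  by have [l [<- _]] := ker_univ K (comp_kin f); rewrite pcompoA phiK pcomp0o.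
have : pull (kin f) (phi tt) = 0 := congr1 (fun h : prohom _ (cst J) => h tt) phi0.
have [i [p pE]] := clsW (phi tt); rewrite pE pullE.
have [t [u _]] := kin_ex f i; rewrite (kinE u) pushE => /(cls_eq0 (X := kpro f))[t' [a aE]].
pose w := cmp u (asrc a).
have [|psi psiE] := @injective_mod_factor _ J _ _ (lmap t') (p \o pmap X w) injJ.
  move=> x /= lx; have [y <-] := mincl_surj lx; rewrite -[RHS](aE y) pmapM /=.
  by congr (p (pmap X u _)); rewrite -kmapE.
exists (to_cst (cls psi)); apply: cst_hom_ext; rewrite pE /= pullE -lvlP pushE (cls_pull w).
by apply: cls_ext => x /=; rewrite psiE.
Qed.

End ConstantTarget.

(** * Isomorphisms in homology, detected by injective modules *)

Section Detection.
Variable k : comPzRingType.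
Implicit Types X Y Z : pro k.

Lemma to_cst_pull X Y (f : prohom X Y) (N : lmodType k) (c : colim Y N) :
  to_cst c \po f = to_cst (pull f c).
Proof. exact: cst_hom_ext. Qed.

(** Once restricted to a further index, a representative of c takes its values in the kernel of q,
    which lies in the image of i. *)
Lemma push_factor X (N J E : lmodType k) (i : {linear N -> J}) (q : {linear J -> E})
  (c : colim X J) : injective i -> (forall y, q y = 0 -> exists x, i x = y) ->
  push q c = 0 -> exists c', push i c' = c.
Proof.
move=> inj_i qi; have [j [g ->]] := clsW c; rewrite pushE => /cls_eq0[l [u e]].
have /dchoice[h hE] x := qi _ (e x).
have hL : linear h.
  move=> a x y; apply: inj_i; rewrite (linearP i) !hE.
  exact: (linearP (g \o pmap X u)).
by exists (cls (mklin hL)); rewrite pushE (cls_pull u g); apply: cls_ext => x; exact: hE.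
Qed.

(* Injective modules cogenerate Mod(k), so they detect all maps to modules, and these
   detect isomorphisms by the Yoneda lemma. *)
Lemma pro_iso_detect X Y (f : prohom X Y) :
  (forall J : lmodType k, injective_mod J ->
     forall g : prohom Y (cst J), g \po f = 0 -> g = 0) ->
  (forall J : lmodType k, injective_mod J -> forall h : prohom X (cst J),
     exists g : prohom Y (cst J), g \po f = h) ->
  pro_iso f.
Proof.
move=> Hinj Hsurj.
have pinj0 (N : lmodType k) (c : colim Y N) : pull f c = 0 -> c = 0.
  have [J [i [injJ inj_i]]] := enough_injectives N => fc.
  apply: (push_inj inj_i); rewrite linear0.
  have g0 : to_cst (push i c) = 0.
    apply: (Hinj _ injJ); rewrite to_cst_pull -pull_push fc.
    by apply: cst_hom_ext; rewrite /= linear0.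
  exact: (congr1 (fun h : prohom _ (cst J) => h tt) g0).
have pinj (N : lmodType k) (c d : colim Y N) : pull f c = pull f d -> c = d.
  by move=> cd; apply/eqP; rewrite -subr_eq0; apply/eqP/pinj0; rewrite linearB /= cd subrr.
(* With 0 -> N -> J -> J' exact, the image of c in [colim X J] comes from some g on Y; the push of g
   to J' is 0 by [pinj0], so g comes from N. *)
have psurj (N : lmodType k) (c : colim X N) : exists d : colim Y N, pull f d = c.
  have [J [i [injJ inj_i]]] := enough_injectives N.
  have [J' [q [injJ' qP]]] := injective_copresentation i.
  have [g gE] := Hsurj _ injJ (to_cst (push i c)).
  have gE' : pull f (g tt) = push i c := congr1 (fun h : prohom _ (cst J) => h tt) gE.
  have [||d dE] := @push_factor Y N J J' i q (g tt) inj_i.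
  - by move=> y /qP.
  - apply: pinj0; rewrite -pull_push gE' push_comp.
    have [j [h ->]] := clsW c; rewrite pushE (cls0 _ j); apply: cls_ext => x /=.
    by apply/qP; exists (h x).
  by exists d; apply: (push_inj inj_i); rewrite pull_push dE.
(* Preimages of the components of the identity form a left inverse of f; it is also a right inverse
   because precomposition with f is injective. *)
have /dchoice[s sE] (j : idx X) := psurj _ (pid X j).
have sC (j j' : idx X) (v : arr j j') : push (pmap X v) (s j) = s j'.
  by apply: pinj; rewrite -pull_push !sE pcompat.
exists (ProHom sC); split; first exact: prohom_ext.
apply: prohom_ext => j; apply: pinj.
have sf : ProHom sC \po f = pid X by exact: prohom_ext.
rewrite -[LHS]/(((f \po ProHom sC) \po f) j) -[RHS]/((pid Y \po f) j).
by rewrite -pcompoA sf pcompo1 pcomp1o.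
Qed.

(** With this, [injective_mod_extend] extends every map from a kernel to an injective module along
    the inclusion. *)
Lemma ker_kernel_zero X Y (f : prohom X Y) (K : kernel f) (L : kernel (ker_in K)) :
  ker_in L = 0.
Proof. by apply: (ker_monic (K := K)); rewrite ker_in0 pcompo0. Qed.

(** Restricted to the cycles, phi kills the boundaries, so it factors through the homology, which is
    zero. Thus phi kills the kernel of the outgoing differential and factors through that
    differential. *)
Lemma exact_seq_factor (C : complex k) n (J : lmodType k) (phi : prohom (C n) (cst J)) :
  exact_seq C -> injective_mod J -> phi \po cd C n = 0 ->
  exists psi, phi = psi \po d_out C n.
Proof.
move=> exC injJ phi0; apply: (injective_mod_extend (K := cycles C n)) => //.
have E : (phi \po ker_in (cycles C n)) \po boundary C n = 0.
  by rewrite -pcompoA ker_liftK.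
have [l [<- _]] := cok_univ (cokernel_of (boundary C n)) E.
by rewrite -[l]pcompo1 (exC n) pcompo0 pcomp0o.
Qed.

Lemma homology_map_class (C D : complex k) (c : chain_map C D) n :
  homology_map c n \po homology_class C n = homology_class D n \po cycles_map c n.
Proof. exact: cok_descK. Qed.

Lemma cycles_map_in (C D : complex k) (c : chain_map C D) n :
  ker_in (cycles D n) \po cycles_map c n = c n \po ker_in (cycles C n).
Proof. exact: ker_liftK. Qed.

Lemma homology_class_epic (C : complex k) n W (g h : prohom (homology C n) W) :
  g \po homology_class C n = h \po homology_class C n -> g = h.
Proof. exact: cok_epic. Qed.

(** The hypotheses say that c is injective, respectively surjective, on the n-th cohomology of the
    complexes of maps to J. For injective J this cohomology is Hom(H_n, J). *)
Lemma homology_map_iso (C D : complex k) (c : chain_map C D) n :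
  (forall J : lmodType k, injective_mod J -> forall (phi : prohom (D n) (cst J)) psi,
     phi \po cd D n = 0 -> phi \po c n = psi \po d_out C n ->
     exists psi', phi = psi' \po d_out D n) ->
  (forall J : lmodType k, injective_mod J -> forall phi : prohom (C n) (cst J),
     phi \po cd C n = 0 -> exists (phi' : prohom (D n) (cst J)) psi,
     phi' \po cd D n = 0 /\ phi = phi' \po c n + psi \po d_out C n) ->
  pro_iso (homology_map c n).
Proof.
move=> Hinj Hsurj.
(* Every map from the homology to J is induced by a cocycle: it is composed with the projection from
   the cycles, then extended to [E n]. *)
have ext (E : complex k) (J : lmodType k) (a : prohom (homology E n) (cst J)) :
    injective_mod J -> exists phi,
    [/\ phi \po ker_in (cycles E n) = a \po homology_class E n & phi \po cd E n = 0].
  move=> injJ.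
  have [phi phiE] : exists phi, a \po homology_class E n = phi \po ker_in (cycles E n).
    by apply: (injective_mod_extend (K := kernel_of _)) => //; rewrite ker_kernel_zero pcompo0.
  exists phi; split=> //.
  have <- : ker_in (cycles E n) \po boundary E n = cd E n by exact: ker_liftK.
  by rewrite pcompoA -phiE -pcompoA cok_out0 pcompo0.
apply: pro_iso_detect => J injJ.
- move=> a a0; have [phi [phiE phi0]] := ext D J a injJ.
  have [|psi psiE] :=
    @injective_mod_extend _ _ _ (d_out C n) (cycles C n) J (phi \po c n) injJ.
    rewrite -pcompoA -cycles_map_in pcompoA phiE -pcompoA -homology_map_class.
    by rewrite pcompoA a0 pcomp0o.
  have [psi' psi'E] := Hinj _ injJ _ _ phi0 psiE.
  apply: homology_class_epic; rewrite -phiE psi'E -pcompoA ker_in0 pcompo0.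
  by rewrite pcomp0o.
- move=> b; have [phi [phiE phi0]] := ext C J b injJ.
  have [phi' [psi [phi'0 E]]] := Hsurj _ injJ _ phi0.
  have a0 : (phi' \po ker_in (cycles D n)) \po boundary D n = 0.
    by rewrite -pcompoA ker_liftK.
  have [a [aE _]] := cok_univ (cokernel_of (boundary D n)) a0.
  exists a; apply: homology_class_epic.
  rewrite -pcompoA homology_map_class pcompoA [a \po _]aE -pcompoA cycles_map_in.
  by rewrite -phiE E pcompoDr -!pcompoA ker_in0 pcompo0 addr0.
Qed.

Lemma homology_map_square (C D C' D' : complex k) (a : chain_map C D) (b : chain_map D D')
  (a' : chain_map C C') (b' : chain_map C' D') n :
  b n \po a n = b' n \po a' n ->
  homology_map b n \po homology_map a n = homology_map b' n \po homology_map a' n.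
Proof.
move=> ba; apply: homology_class_epic.
rewrite -!pcompoA !homology_map_class !pcompoA !homology_map_class -!pcompoA.
congr (_ \po _); apply: (ker_monic (K := cycles D' n)).
by rewrite !pcompoA !cycles_map_in -!pcompoA !cycles_map_in !pcompoA ba.
Qed.
End Detection.

(** * Double complexes *)

Section DoubleComplexChase.
Variables (A : nat -> nat -> zmodType) (B : nat -> zmodType).
Variables (d1 : forall p q, {additive A p q -> A p.+1 q})
  (d2 : forall p q, {additive A p q -> A p q.+1})
  (eps : forall p, {additive B p -> A p 0%N}).

Definition shift1 (f : forall p q, A p q) p q : A p q :=
  if p is p'.+1 then d1 p' q (f p' q) else 0.

(* No grading is imposed: a cochain of total degree n is extended by 0. *)
Lemma double_complex_chase (phi : forall p q, A p q) :
  (forall p q x, d1 p.+1 q (d1 p q x) = 0) ->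
  (forall p q x, d1 p q.+1 (d2 p q x) + d2 p.+1 q (d1 p q x) = 0) ->
  (forall p x, d2 p 0%N x = 0 -> exists b, x = eps p b) ->
  (forall p q x, d2 p q.+1 x = 0 -> exists y, x = d2 p q y) ->
  (forall p q, shift1 phi p q.+1 + d2 p q (phi p q) = 0) ->
  exists (psi : forall p q, A p q) (b : forall p, B p),
    (forall p, phi p 0%N = shift1 psi p 0%N + eps p (b p)) /\
    (forall p q, phi p q.+1 = shift1 psi p q.+1 + d2 p q (psi p q)).
Proof.
move=> d11 d12 ex0 ex phi0.
(* [prev] stands for the d1-image of the solution x in column p - 1; in column 0 it is 0. *)
pose good p (prev : forall q, A p q) (x : forall q, A p q) :=
  forall q, phi p q.+1 = prev q.+1 + d2 p q (x q).
(* By the cocycle condition phi - d1 x is d2-closed in column p + 1, hence d2-exact in rows q >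
   0. *)
have step p (x prev : forall q, A p q) : good p prev x ->
    (forall q, d1 p q.+1 (prev q.+1) = 0) ->
    exists y, good p.+1 (fun q => d1 p q (x q)) y.
  move=> gx prev0.
  have closed q : d2 p.+1 q (phi p.+1 q - d1 p q (x q)) = 0.
    have /eqP := phi0 p.+1 q; rewrite addr_eq0 /= gx raddfD prev0 add0r => /eqP E.
    have /eqP := d12 p q (x q); rewrite addr_eq0 E => /eqP E'.
    by rewrite raddfB; apply/eqP; rewrite subr_eq0; apply/eqP/oppr_inj.
  have /dchoice[y yE] q := ex _ _ _ (closed q.+1).
  by exists y => q; rewrite -yE addrC subrK.
have [x0 gx0] : exists x0, good 0%N (fun=> 0) x0.
  have /dchoice[y yE] q : exists y, phi 0%N q.+1 = d2 0%N q y.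
    by apply: ex; have := phi0 0%N q.+1; rewrite /= add0r.
  by exists y => q; rewrite add0r.
(* The solutions are chosen column by column; each stage carries the invariant, used by [step], that
   [prev] is d1-closed in rows q > 0. *)
pose T p := {x : (forall q, A p q) * (forall q, A p q) |
  good p x.1 x.2 /\ forall q, d1 p q.+1 (x.1 q.+1) = 0}.
have /dchoice[next nextE] (t : {p & T p}) : exists t' : T (projT1 t).+1,
    (sval t').1 = fun q => d1 _ q ((sval (projT2 t)).2 q).
  case: t => p [[prev x] [/= gx prev0]] /=; have [y gy] := step _ _ _ gx prev0.
  have H : good p.+1 (fun q => d1 p q (x q)) y /\
      (forall q, d1 p.+1 q.+1 (d1 p q.+1 (x q.+1)) = 0) by split.
  by exists (exist _ (_, _) H).
have H0 : good 0%N (fun=> 0) x0 /\ forall q, d1 0%N q.+1 0 = 0 by split=> // q; rewrite raddf0.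
pose sol := fix sol p : T p := if p is p'.+1 then next (existT T p' (sol p'))
  else exist _ (_, _) H0.
pose psi p q := (sval (sol p)).2 q.
have solE p : (sval (sol p)).1 = shift1 psi p.
  by case: p => [//|p]; exact: (nextE (existT T p (sol p))).
have psiE p q : phi p q.+1 = shift1 psi p q.+1 + d2 p q (psi p q).
  by have [g _] := svalP (sol p); rewrite g solE.
(* In row 0 the difference is again d2-closed, and exactness there yields an element of B p instead
   of a primitive. *)
have /dchoice[b bE] p : exists b, phi p 0%N - shift1 psi p 0%N = eps p b.
  apply: ex0; case: p => [|p] /=.
    by rewrite subr0; have := phi0 0%N 0%N; rewrite add0r.
  have /eqP := phi0 p.+1 0%N; rewrite addr_eq0 /= psiE raddfD.
  have -> : d1 p 1%N (shift1 psi p 1%N) = 0.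
    by case: (p) => [|p'] /=; rewrite ?raddf0 ?d11.
  rewrite add0r => /eqP E; have /eqP := d12 p 0%N (psi p 0%N); rewrite addr_eq0 E => /eqP E'.
  by rewrite raddfB; apply/eqP; rewrite subr_eq0; apply/eqP/oppr_inj.
by exists psi, b; split=> // p; rewrite -bE addrC subrK.
Qed.
End DoubleComplexChase.

(** * Exactness of tensor products, seen by maps to a fixed target *)

Section TensorExact.
Variable k : comPzRingType.

(** By adjunction x is a linear map from Q to Hom(Y, N). Its values kill f, hence have the form
    [psi \po g]; as Q is projective, psi can be chosen linearly. *)
Lemma tens_projective_exact (Q : lmodType k) (X Y Z : pro k) (f : prohom X Y) (g : prohom Y Z)
  (N : pro k) (x : prohom (tens Y Q) N) : projective_mod Q ->
  (forall phi : prohom Y N, phi \po f = 0 -> exists psi, phi = psi \po g) ->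
  x \po tens_map f (idfun : {linear Q -> Q}) = 0 ->
  exists y, x = y \po tens_map g (idfun : {linear Q -> Q}).
Proof.
move=> projQ fg x0.
have gL : linear (fun psi : prohom Z N => psi \po g).
  by move=> a u v; rewrite pcompoPr.
have [m|h hE] := @projective_mod_lift _ _ _ _ (mklin gL) (tens_adj x) projQ.
  have [|psi psiE] := fg (tens_adj x m); last by exists psi.
  by rewrite -[m]/((idfun : {linear Q -> Q}) m) -tens_adj_map x0 tens_adjE pcomp0o.
have [y yE] := tens_adj_surj h; exists y.
by apply: tens_adj_inj; apply: linear_ext => m; rewrite tens_adj_map yE -hE.
Qed.

(** By adjunction x is a linear map from V to Hom(P, N). It kills the image of f, hence the kernel
    of g, and so factors through g. *)
Lemma tens_injective_exact (P : pro k) (U V W : lmodType k) (f : {linear U -> V})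
  (g : {linear V -> W}) (N : pro k) (x : prohom (tens P V) N) :
  injective_mod (prohom P N) -> (forall v, g v = 0 -> exists u, f u = v) ->
  x \po tens_map (pid P) f = 0 -> exists y, x = y \po tens_map (pid P) g.
Proof.
move=> injN fg x0.
have [v|h hE] := @injective_mod_factor _ _ _ _ g (tens_adj x) injN.
  by move=> /fg[u <-]; rewrite -[LHS]pcompo1 -tens_adj_map x0 tens_adjE pcomp0o.
have [y yE] := tens_adj_surj h; exists y.
by apply: tens_adj_inj; apply: linear_ext => v; rewrite tens_adj_map yE pcompo1 hE.
Qed.
End TensorExact.

(** * Total complexes and their augmentations *)

Section Total.
Variable k : comPzRingType.

(** Squares anticommute, so that the total differential is the sum of [bh] and [bv] without
    signs. *)
Record bicomplex := Bicomplex {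
  bob :> nat -> nat -> pro k;
  bh : forall p q, prohom (bob p.+1 q) (bob p q);
  bv : forall p q, prohom (bob p q.+1) (bob p q);
  bhh : forall p q, bh p q \po bh p.+1 q = 0;
  bvv : forall p q, bv p q \po bv p q.+1 = 0;
  bhv : forall p q, bh p q \po bv p.+1 q + bv p q \po bh p q.+1 = 0 }.

(** With it, one result on augmented columns serves both resolutions. *)
Definition transpose (T : bicomplex) : bicomplex.
Proof.
exists (fun p q => T q p) (fun p q => bv T q p) (fun p q => bh T q p) => p q.
- exact: bvv.
- exact: bhh.
- by rewrite addrC bhv.
Defined.

Definition hpart (T : bicomplex) W (f : forall p q, prohom (T p q) W) p q : prohom (T p q) W :=
  match p with p'.+1 => f p' q \po bh T p' q | 0 => 0 end.

Definition vpart (T : bicomplex) W (f : forall p q, prohom (T p q) W) p q : prohom (T p q) W :=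
  match q with q'.+1 => f p q' \po bv T p q' | 0 => 0 end.

Lemma hpart_bh (T : bicomplex) W (f : forall p q, prohom (T p q) W) p q :
  hpart f p q \po bh T p q = 0.
Proof. by case: p => [|p] /=; rewrite ?pcomp0o // -pcompoA bhh pcompo0. Qed.

(* C is the total complex of T, up to isomorphism: the maps incl n p q with
   p + q = n form a coproduct, the other ones are 0. *)
Record total (T : bicomplex) (C : complex k)
  (incl : forall n p q, prohom (T p q) (C n)) : Prop := Total {
  tot_off : forall n p q, (p + q)%N <> n -> incl n p q = 0;
  tot_desc : forall n W (f : forall p q, prohom (T p q) W), exists l : prohom (C n) W,
    forall p q, (p + q)%N = n -> l \po incl n p q = f p q;
  tot_epic : forall n W (g g' : prohom (C n) W),
    (forall p q, g \po incl n p q = g' \po incl n p q) -> g = g';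
  tot_d : forall n p q,
    cd C n \po incl n.+1 p q = hpart (incl n) p q + vpart (incl n) p q }.

(** The complex C stays the same, so both augmentations start from one total complex. *)
Lemma total_transpose T C incl : @total T C incl ->
  @total (transpose T) C (fun n p q => incl n q p).
Proof.
move=> [off desc epic d]; split.
- by move=> n p q pq; apply: off; rewrite addnC.
- move=> n W f; have [l lE] := desc n W (fun p q => f q p).
  by exists l => p q pq; rewrite lE // addnC.
- by move=> n W g g' gg'; apply: epic => p q; exact: gg'.
- by move=> n p q; rewrite d addrC.
Qed.

Section Construction.
Variable T : bicomplex.

Definition tot_cop n :=
  coproduct_of (fun s : {x : nat * nat | (x.1 + x.2)%N = n} => T (sval s).1 (sval s).2).
Definition tot_ob n : pro k := cop_obj (tot_cop n).

(** Setting the maps off the diagonal to 0 keeps equations between degrees out of the types. *)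
Definition tot_in n p q : prohom (T p q) (tot_ob n) :=
  match pselect ((p + q)%N = n) with
  | left e => cop_in (tot_cop n) (exist _ (p, q) e)
  | right _ => 0
  end.

Lemma tot_in_off n p q : (p + q)%N <> n -> tot_in n p q = 0.
Proof. by rewrite /tot_in; case: pselect. Qed.

Lemma tot_inE n s : cop_in (tot_cop n) s = tot_in n (sval s).1 (sval s).2.
Proof.
case: s => -[p q] e; rewrite /tot_in /=; case: pselect => // e'.
by rewrite (Prop_irrelevance e' e).
Qed.

Lemma tot_in_desc n W (f : forall p q, prohom (T p q) W) : exists l : prohom (tot_ob n) W,
  forall p q, (p + q)%N = n -> l \po tot_in n p q = f p q.
Proof.
have [l [lE _]] := cop_univ (tot_cop n) (fun s => f (sval s).1 (sval s).2).
by exists l => p q e; have := lE (exist _ (p, q) e); rewrite tot_inE.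
Qed.

Lemma tot_in_epic n W (g g' : prohom (tot_ob n) W) :
  (forall p q, g \po tot_in n p q = g' \po tot_in n p q) -> g = g'.
Proof. by move=> gg'; apply: cop_epic => s; rewrite tot_inE gg'. Qed.

Definition tot_cd n : prohom (tot_ob n.+1) (tot_ob n) :=
  sval (cid (tot_in_desc n.+1 (fun p q => hpart (tot_in n) p q + vpart (tot_in n) p q))).

Lemma tot_cdE n p q :
  tot_cd n \po tot_in n.+1 p q = hpart (tot_in n) p q + vpart (tot_in n) p q.
Proof.
rewrite /tot_cd; case: cid => l /= lE.
have [e|e] := pselect ((p + q)%N = n.+1); first exact: lE.
rewrite tot_in_off // pcompo0; case: p q e => [|p] [|q] e /=; rewrite ?addr0 ?add0r //.
- by rewrite tot_in_off ?pcomp0o // => e'; apply: e; rewrite -e'.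
- by rewrite tot_in_off ?pcomp0o // => e'; apply: e; rewrite -e'.
- rewrite !tot_in_off ?pcomp0o ?addr0 // => e'; apply: e; rewrite -e' ?addnS //.
Qed.

Lemma tot_cdd n : tot_cd n \po tot_cd n.+1 = 0.
Proof.
apply: tot_in_epic => p q; rewrite pcomp0o -pcompoA tot_cdE pcompoDl.
(* After a further [bh] only the vertical part survives, by [bhh], and likewise for [bv]; the two
   mixed terms then cancel by [bhv]. *)
have H p' q' : tot_cd n \po (tot_in n.+1 p' q' \po bh T p' q') =
    vpart (tot_in n) p' q' \po bh T p' q'.
  rewrite pcompoA tot_cdE pcompoDr; case: p' => [|p'] /=; first by rewrite pcomp0o add0r.
  by rewrite -pcompoA bhh pcompo0 add0r.
have V p' q' : tot_cd n \po (tot_in n.+1 p' q' \po bv T p' q') =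
    hpart (tot_in n) p' q' \po bv T p' q'.
  rewrite pcompoA tot_cdE pcompoDr; case: q' => [|q'] /=; first by rewrite pcomp0o addr0.
  by rewrite -[X in _ + X]pcompoA bvv pcompo0 addr0.
case: p q => [|p] [|q] /=; rewrite ?H ?V /= ?(pcompo0, pcomp0o, addr0) //.
by rewrite -!pcompoA -pcompoDl addrC bhv pcompo0.
Qed.

Definition tot : complex k := Complex tot_cdd.

Lemma tot_total : @total T tot tot_in.
Proof. by split; [exact: tot_in_off|exact: tot_in_desc|exact: tot_in_epic|exact: tot_cdE]. Qed.
End Construction.

Section Augmentation.
Variables (T : bicomplex) (C : complex k) (incl : forall n p q, prohom (T p q) (C n)).
Variable tC : total incl.
Variables (D : complex k) (eps : forall p, prohom (T p 0%N) (D p)).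
Hypothesis epsh : forall p, eps p \po bh T p 0%N = cd D p \po eps p.+1.
Hypothesis epsv : forall p, eps p \po bv T p 0%N = 0.

Lemma aug_ex n : exists l : prohom (C n) (D n),
  l \po incl n n 0%N = eps n /\ forall p q, l \po incl n p q.+1 = 0.
Proof.
have [l lE] := tot_desc tC n (fun p q => match q return prohom (T p q) (D n) with
  | 0%N => match pselect (p = n) with
          | left e => ecast m (prohom (T p 0%N) (D m)) e (eps p)
          | right _ => 0
          end
  | _ => 0 end).
exists l; split=> [|p q].
  by rewrite lE ?addn0 //; case: pselect => // e; rewrite (Prop_irrelevance e erefl).
have [e|e] := pselect ((p + q.+1)%N = n); first by rewrite lE.
by rewrite (tot_off tC) // pcompo0.
Qed.

Definition aug_fun n : prohom (C n) (D n) := sval (cid (aug_ex n)).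
Lemma aug_fun0 n : aug_fun n \po incl n n 0%N = eps n.
Proof. by rewrite /aug_fun; case: cid => l []. Qed.
Lemma aug_funS n p q : aug_fun n \po incl n p q.+1 = 0.
Proof. by rewrite /aug_fun; case: cid => l []. Qed.

Lemma aug_funP n : cd D n \po aug_fun n.+1 = aug_fun n \po cd C n.
Proof.
apply: (tot_epic tC) => p q; rewrite -!pcompoA.
have [e|e] := pselect ((p + q)%N = n.+1); last by rewrite (tot_off tC) // !pcompo0.
case: q e => [|q] e.
  rewrite addn0 in e; rewrite e aug_fun0 (tot_d tC) /= addr0 pcompoA aug_fun0 //.
rewrite aug_funS pcompo0 (tot_d tC) pcompoDl /= pcompoA.
(* [aug_fun] is nonzero only in row 0, that is for q = 0 and p = n, where [epsv] applies. *)
have -> : aug_fun n \po incl n p q \po bv T p q = 0.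
  case: q e => [|q] e; last by rewrite aug_funS pcomp0o.
  have -> : p = n by move: e; rewrite addn1 => -[].
  by rewrite aug_fun0 epsv.
by case: p {e} => [|p]; rewrite /= ?pcompo0 ?addr0 // pcompoA aug_funS pcomp0o.
Qed.

Definition aug_map : chain_map C D := ChainMap aug_funP.

Definition precomp X Y (f : prohom X Y) (J : lmodType k) :
  {additive prohom Y (cst J) -> prohom X (cst J)} :=
  mkadd (fun g g' => pcompoBr g g' f : (g - g') \po f = g \po f - g' \po f).

(** Hom(-, J) makes each augmented column D_p <- T_(p,0) <- T_(p,1) <- ... exact. *)
Definition cochain_col_exact : Prop := forall J : lmodType k, injective_mod J ->
  [/\ forall p (b : prohom (D p) (cst J)), b \po eps p = 0 -> b = 0,
      forall p (x : prohom (T p 0%N) (cst J)), x \po bv T p 0%N = 0 ->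
        exists b, x = b \po eps p
    & forall p q (x : prohom (T p q.+1) (cst J)), x \po bv T p q.+1 = 0 ->
        exists y, x = y \po bv T p q].

(** The cocycle condition concerns rows q > 0 only, because the chase is also applied to a cochain
    whose coboundary comes from D and is concentrated in row 0. A single b is enough, as
    [incl n p 0] vanishes unless p = n. *)
Lemma aug_chase (J : lmodType k) n (x : prohom (C n) (cst J)) :
  cochain_col_exact -> injective_mod J ->
  (forall p q, x \po (cd C n \po incl n.+1 p q.+1) = 0) ->
  exists (psi : forall p q, prohom (T p q) (cst J)) (b : prohom (D n) (cst J)),
   [/\ x \po incl n n 0%N = hpart psi n 0%N + b \po eps n &
   forall p q, x \po incl n p q.+1 = hpart psi p q.+1 + psi p q \po bv T p q].
Proof.
move=> H injJ x0; have [E2 E0 E1] := H J injJ.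
have [||||| psi [b [b0 bS]]] := @double_complex_chase (fun p q => prohom (T p q) (cst J))
  (fun p => prohom (D p) (cst J)) (fun p q => precomp (bh T p q) J)
  (fun p q => precomp (bv T p q) J) (fun p => precomp (eps p) J) (fun p q => x \po incl n p q).
- by move=> p q y /=; rewrite -pcompoA bhh pcompo0.
- by move=> p q y /=; rewrite -!pcompoA -pcompoDl addrC bhv pcompo0.
- by move=> p y /= /E0.
- by move=> p q y /= /E1.
- move=> p q; rewrite -[RHS](x0 p q) (tot_d tC) pcompoDl /= pcompoA; congr (_ + _).
  by case: p => [|p] /=; rewrite ?pcompo0 // pcompoA.
exists psi, (b n); split; first by rewrite b0; case: (n).
by move=> p q; rewrite bS; case: p.
Qed.

(** l collects the components of psi in total degree n - 1; for n = 0 there are none, and both parts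
    vanish at p = q = 0. *)
Lemma d_out_desc (J : lmodType k) n (psi : forall p q, prohom (T p q) (cst J)) :
  exists l, forall p q, (p + q)%N = n ->
    l \po d_out C n \po incl n p q = hpart psi p q + vpart psi p q.
Proof.
case: n => [|n].
  by exists 0 => -[|p] [|q] //= _; rewrite !pcomp0o addr0.
have [l lE] := tot_desc tC n psi; exists l => p q e.
rewrite -pcompoA (tot_d tC) pcompoDl; congr (_ + _).
  case: p e => [|p] e /=; first by rewrite pcompo0.
  by rewrite pcompoA lE //; case: e.
case: q e => [|q] e /=; first by rewrite pcompo0.
by rewrite pcompoA lE //; move: e; rewrite addnS => -[].
Qed.

Lemma aug_map_quasi_iso n : cochain_col_exact -> pro_iso (homology_map aug_map n).
Proof.
move=> H; apply: homology_map_iso => J injJ; have [E2 _ _] := H J injJ.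
(* Injectivity: phi becomes the coboundary of chi on C. The chase turns chi into b on D, and that
   phi is the coboundary of b is checked after composition with eps. In degree 0 the only coboundary
   is 0. *)
- case: n => [|n] phi chi phi0 phi_aug.
    exists 0; rewrite pcomp0o; apply: E2.
    by rewrite -aug_fun0 pcompoA [phi \po _]phi_aug /= pcompo0 pcomp0o.
  have [|psi [b [bE _]]] := @aug_chase J n chi H injJ.
    move=> p q; rewrite pcompoA -[chi \po _]phi_aug -pcompoA.
    by rewrite [_ \po incl _ _ _]aug_funS pcompo0.
  exists b; apply/eqP; rewrite -subr_eq0; apply/eqP/E2.
  rewrite pcompoBr -(aug_fun0 n.+1) pcompoA [phi \po _]phi_aug -pcompoA (tot_d tC) /= addr0.
  by rewrite pcompoA bE pcompoDr hpart_bh add0r aug_fun0 -!pcompoA epsh subrr.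
(* Surjectivity: the chase writes phi as the pullback of b plus the coboundary of psi; that b is a
   cocycle is again checked after composition with eps. *)
- move=> phi phi0; have [|psi [b [b0 bS]]] := @aug_chase J n phi H injJ.
    by move=> p q; rewrite pcompoA phi0 pcomp0o.
  have [l lE] := d_out_desc n psi.
  exists b, l; split.
    apply: E2; rewrite -pcompoA -epsh pcompoA.
    have -> : b \po eps n = phi \po incl n n 0%N - hpart psi n 0%N.
      by rewrite b0 [X in X - _]addrC addrK.
    have := tot_d tC n n.+1 0%N; rewrite /= addr0 => E.
    by rewrite pcompoBr hpart_bh -pcompoA -E pcompoA phi0 pcomp0o subrr.
  apply: (tot_epic tC) => p q.
  have [e|e] := pselect ((p + q)%N = n); last by rewrite (tot_off tC) // !pcompo0.
  rewrite pcompoDr lE // -pcompoA; case: q e => [|q] e.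
    by rewrite addn0 in e; subst p; rewrite b0 [_ \po incl _ _ _]aug_fun0 /= addr0 addrC.
  by rewrite bS [_ \po incl _ _ _]aug_funS pcompo0 add0r.
Qed.
End Augmentation.
End Total.

Section TotalMap.
Variables (k : comPzRingType) (T T' : bicomplex k) (C C' : complex k).
Variables (incl : forall n p q, prohom (T p q) (C n))
  (incl' : forall n p q, prohom (T' p q) (C' n)).
Variables (tC : total incl) (tC' : total incl').
Variable m : forall p q, prohom (T p q) (T' p q).
Hypothesis mh : forall p q, m p q \po bh T p q = bh T' p q \po m p.+1 q.
Hypothesis mv : forall p q, m p q \po bv T p q = bv T' p q \po m p q.+1.

Lemma total_map : exists c : chain_map C C',
  forall n p q, c n \po incl n p q = incl' n p q \po m p q.
Proof.
have /dchoice[c cE0] n := tot_desc tC n (fun p q => incl' n p q \po m p q).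
have cE n p q : c n \po incl n p q = incl' n p q \po m p q.
  have [e|e] := pselect ((p + q)%N = n); first exact: cE0.
  by rewrite (tot_off tC) // (tot_off tC') // pcompo0 pcomp0o.
suff cP n : cd C' n \po c n.+1 = c n \po cd C n by exists (ChainMap cP).
apply: (tot_epic tC) => p q; rewrite -!pcompoA cE (tot_d tC) pcompoDl.
rewrite pcompoA (tot_d tC') pcompoDr.
congr (_ + _).
  by case: p => [|p] /=; rewrite ?pcomp0o ?pcompo0 // pcompoA cE -!pcompoA mh.
by case: q => [|q] /=; rewrite ?pcomp0o ?pcompo0 // pcompoA cE -!pcompoA mv.
Qed.

Lemma aug_fun_natural (D D' : complex k) (eps : forall p, prohom (T p 0%N) (D p))
  (eps' : forall p, prohom (T' p 0%N) (D' p)) n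
  (c : prohom (C n) (C' n)) (d : prohom (D n) (D' n)) :
  (forall p q, c \po incl n p q = incl' n p q \po m p q) ->
  d \po eps n = eps' n \po m n 0%N ->
  aug_fun tC' eps' n \po c = d \po aug_fun tC eps n.
Proof.
move=> cE dE; apply: (tot_epic tC) => p q.
have [e|e] := pselect ((p + q)%N = n); last by rewrite (tot_off tC) // !pcompo0.
rewrite -!pcompoA cE pcompoA; case: q e => [|q] e.
  by rewrite addn0 in e; subst p; rewrite !aug_fun0 dE.
by rewrite !aug_funS pcompo0 pcomp0o.
Qed.
End TotalMap.

(** * The bicomplex of the two resolutions *)

Section TensorBicomplex.
Variables (k : comPzRingType) (M : pro k) (P : qp_resolution M).
Variables (G : lmodType k) (Q : proj_resolution G).

(** The sign (-1)^p turns commuting squares into anticommuting ones. *)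
Definition tens_bicomplex : bicomplex k.
Proof.
exists (fun p q => tens (P p) (Q q))
  (fun p q => tens_map (cd P p) (idfun : {linear Q q -> Q q}))
  (fun p q => (-1) ^+ p *: tens_map (pid (P p)) (pr_d Q q)) => p q.
- by rewrite tens_mapM cdd tens_map0l.
- rewrite pcompoZl pcompoZr tens_mapM tens_map0r ?scaler0 // => x /=.
  by apply/pr_exact; exists x.
- rewrite pcompoZl pcompoZr !tens_mapM pcompo1 pcomp1o exprS mulN1r scaleNr.
  apply/eqP; rewrite addrC subr_eq0; apply/eqP; congr (_ *: _); exact: eq_tens_map.
Defined.

Let T := tens_bicomplex.
Let C := tot T.

Definition epsl p : prohom (T p 0%N) (tens_complexl G P p) :=
  tens_map (pid (P p)) (pr_aug Q).
Definition epsr q : prohom (T 0%N q) (tens_complexr M Q q) :=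
  tens_map (qp_aug P) (idfun : {linear Q q -> Q q}).

Lemma epsl_bh p : epsl p \po bh T p 0%N = cd (tens_complexl G P) p \po epsl p.+1.
Proof. by rewrite /epsl /= !tens_mapM pcomp1o pcompo1; exact: eq_tens_map. Qed.

Lemma epsl_bv p : epsl p \po bv T p 0%N = 0.
Proof.
rewrite /epsl /= pcompoZl tens_mapM tens_map0r ?scaler0 // => x /=.
by apply/pr_exact0; exists x.
Qed.

Lemma epsr_bv q : epsr q \po bv T 0%N q = cd (tens_complexr M Q) q \po epsr q.+1.
Proof. by rewrite /epsr /= expr0 scale1r !tens_mapM pcomp1o pcompo1; exact: eq_tens_map. Qed.

Lemma epsr_bh q : epsr q \po bh T 0%N q = 0.
Proof. by rewrite /epsr /= tens_mapM qp_aug0 tens_map0l. Qed.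

Definition tot_to_left : chain_map C (tens_complexl G P) :=
  aug_map (tot_total T) epsl_bh epsl_bv.

Definition tot_to_right : chain_map C (tens_complexr M Q) :=
  @aug_map k (transpose T) C _ (total_transpose (tot_total T)) _ epsr epsr_bv epsr_bh.

Lemma epsl_exact : quasi_noetherian k -> cochain_col_exact epsl.
Proof.
move=> hk J injJ; have injP p := hk _ (@qp_qproj _ _ P p) _ injJ.
have unsign p q (x : prohom (T p q) (cst J)) : x \po bv T p q = 0 ->
    x \po tens_map (pid (P p)) (pr_d Q q) = 0.
  move=> /=; rewrite pcompoZl => /(congr1 ( *:%R ((-1) ^+ p))).
  by rewrite scaler0 scalerA -expr2 sqrr_sign scale1r.
split=> [p b b0|p x /unsign x0|p q x /unsign x0].
(* For g = 0 the kernel is all of G, which [pr_aug] covers; so b factors through a zero map. *)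
- have [v _|y ->] := tens_injective_exact (g := \0 : {linear G -> G}) (injP p) _ b0.
    exact: pr_aug_surj.
  by rewrite tens_map0r // pcompo0.
- by apply: (tens_injective_exact (injP p) _ x0) => v /pr_exact0.
- have [v /pr_exact//|y ->] := tens_injective_exact (g := pr_d Q q) (injP p) _ x0.
  exists ((-1) ^+ p *: y).
  by rewrite /= pcompoZl pcompoZr scalerA -expr2 sqrr_sign scale1r.
Qed.

Lemma epsr_exact : @cochain_col_exact k (transpose T) (tens_complexr M Q) epsr.
Proof.
move=> J injJ; have ex n phi := @exact_seq_factor _ _ n J phi (@qp_exact _ _ P) injJ.
have projQ q := @pr_proj _ _ Q q.
split=> [q b b0|q x x0|q p x x0].
(* [ex] refers to the augmented sequence, where P_n sits in degree n + 1 and the differential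
   leaving M in degree 0 is zero. *)
- have [y ->] := tens_projective_exact (projQ q) (ex 0%N) b0.
  by rewrite /= tens_map0l pcompo0.
- exact: (tens_projective_exact (projQ q) (ex 1%N) x0).
- exact: (tens_projective_exact (projQ q) (ex p.+2) x0).
Qed.

Lemma tot_to_left_iso n : quasi_noetherian k -> pro_iso (homology_map tot_to_left n).
Proof. by move=> hk; apply: aug_map_quasi_iso; exact: epsl_exact. Qed.

Lemma tot_to_right_iso n : pro_iso (homology_map tot_to_right n).
Proof. by apply: (@aug_map_quasi_iso k (transpose T)); exact: epsr_exact. Qed.

End TensorBicomplex.

(** The maps p_i (x) q_j assemble to a single chain map compatible with both augmentations, which
    gives the naturality of theta. *)
Lemma tens_bicomplex_map (k : comPzRingType) (M M' : pro k) (f : prohom M M')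
    (P : qp_resolution M) (P' : qp_resolution M') (p : qp_map f P P')
    (G G' : lmodType k) (g : {linear G -> G'})
    (Q : proj_resolution G) (Q' : proj_resolution G') (q : pr_map g Q Q') :
  exists c : chain_map (tot (tens_bicomplex P Q)) (tot (tens_bicomplex P' Q')),
  forall n, tot_to_left P' Q' n \po c n = tens_chain_mapl g p n \po tot_to_left P Q n /\
            tot_to_right P' Q' n \po c n = tens_chain_mapr f q n \po tot_to_right P Q n.
Proof.
pose m i j : prohom (tens_bicomplex P Q i j) (tens_bicomplex P' Q' i j) :=
  tens_map (p i) (q j).
have [||c cE] := @total_map k _ _ _ _ _ _ (tot_total (tens_bicomplex P Q))
  (tot_total (tens_bicomplex P' Q')) m.
- by move=> i j; rewrite /m /= !tens_mapM cmP; exact: eq_tens_map.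
- move=> i j; rewrite /m /= pcompoZl pcompoZr !tens_mapM pcomp1o pcompo1; congr (_ *: _).
  by apply: eq_tens_map => x /=; rewrite pr_cmP.
exists c => n; split.
- apply: aug_fun_natural => //; rewrite /m /epsl /= !tens_mapM pcomp1o pcompo1.
  by apply: eq_tens_map => x /=; rewrite pr_mapP.
- apply: (@aug_fun_natural k (transpose _) (transpose _) _ _ _ _ _ _ (fun i j => m j i)).
    by move=> i j; exact: cE.
  by rewrite /m /epsr /= !tens_mapM qp_mapP; exact: eq_tens_map.
Qed.

Theorem proposition2p35 (k : comPzRingType) (hk : quasi_noetherian k) :
  exists theta : forall (M : pro k) (P : qp_resolution M)
      (G : lmodType k) (Q : proj_resolution G) (n : nat),
      prohom (homology (tens_complexl G P) n) (Tor M Q n),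
    (forall (M : pro k) (P : qp_resolution M) (G : lmodType k)
       (Q : proj_resolution G) (n : nat), pro_iso (theta M P G Q n)) /\
    (forall (M M' : pro k) (f : prohom M M')
       (P : qp_resolution M) (P' : qp_resolution M') (p : qp_map f P P')
       (G G' : lmodType k) (g : {linear G -> G'})
       (Q : proj_resolution G) (Q' : proj_resolution G') (q : pr_map g Q Q')
       (n : nat),
     theta M' P' G' Q' n \po homology_map (tens_chain_mapl g p) n =
     Tor_map f q n \po theta M P G Q n).
Proof.
pose L M P G Q n := homology_map (@tot_to_left k M P G Q) n.
pose R M P G Q n := homology_map (@tot_to_right k M P G Q) n.
pose inv M P G Q n := sval (cid (@tot_to_left_iso k M P G Q n hk)).
have invP M P G Q n : inv M P G Q n \po L M P G Q n = pid _ /\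
    L M P G Q n \po inv M P G Q n = pid _.
  by rewrite /inv; case: cid.
exists (fun M P G Q n => R M P G Q n \po inv M P G Q n); split.
- move=> M P G Q n; have [S [SR RS]] := @tot_to_right_iso k M P G Q n.
  have [iL Li] := invP M P G Q n.
  exists (L M P G Q n \po S); split.
    by rewrite -pcompoA (pcompoA S) SR pcomp1o.
  by rewrite -pcompoA (pcompoA (inv _ _ _ _ _)) iL pcomp1o.
- move=> M M' f P P' p G G' g Q Q' q n.
  have [c cE] := tens_bicomplex_map p q.
  have EL : L M' P' G' Q' n \po homology_map c n =
      homology_map (tens_chain_mapl g p) n \po L M P G Q n.
    by apply: homology_map_square; have [] := cE n.
  have ER : R M' P' G' Q' n \po homology_map c n = Tor_map f q n \po R M P G Q n.
    by apply: homology_map_square; have [] := cE n.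
  have [iL Li] := invP M P G Q n; have [iL' Li'] := invP M' P' G' Q' n.
  (* The identity L inv is inserted on the right; [EL] then brings the L of the target next to its
     inverse, and [ER] concludes. *)
  rewrite -[homology_map (tens_chain_mapl g p) n]pcompo1 -Li (pcompoA _ (L _ _ _ _ _)) -EL.
  by rewrite !pcompoA -(pcompoA (R _ _ _ _ _)) iL' pcompo1 ER.
Qed.
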